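(* Let $B$ be a standard Koszul Artin-Schelter Gorenstein algebra of graded injective dimension $d$, let $S=B_0$ and $D(S)=\mathrm{Hom}_\Bbbk(S,\Bbbk)$. Then: (i) $S$ is selfinjective; (ii) ${}_BD(S)$ (resp. $D(S)_B$) is a Koszul $B$-module with projective dimension $\mathrm{pdim}\,{}_BD(S)=d$ (resp. $\mathrm{pdim}\,D(S)_B=d$).
   Context: $\Bbbk$ is a fixed field. $B=\bigoplus_{i\ge0}B_i$ is a positively graded $\Bbbk$-algebra with $\dim_\Bbbk B_i<\infty$ for all $i$, and $S=B_0$ (a finite dimensional algebra, not assumed semisimple). $D(S)$ is viewed as a graded left or right $B$-module concentrated in degree zero (via $B\to B/B_{\ge1}=S$). $B$ is Artin-Schelter Gorenstein if: (i) the graded injective dimensions satisfy $\mathrm{injdim}\,B_B=\mathrm{injdim}\,{}_BB=d<\infty$; (ii) as graded (left) $B$-modules, $\underline{\mathrm{Ext}}^i_B(S_B,B)=0$ for $i\ne d$ and $\underline{\mathrm{Ext}}^d_B(S_B,B)\cong D(S)(l)$, where $N(l)_i=N_{i+l}$; (iii) the left version of (ii) holds. The integer $l$ is the Gorenstein parameter. $B$ is Koszul if every $B_i$ ($i\ge1$) is projective as a left and as a right $S$-module, and $S_B$ has a graded projective resolution whose $n$-th term is generated in degree $n$ for all $n\ge0$. $B$ is standard Koszul Artin-Schelter Gorenstein if it is Artin-Schelter Gorenstein, Koszul, and $l=d$. A graded $B$-module (generated in degree $0$) is a Koszul module if it has a graded projective resolution whose $n$-th term is generated in degree $n$ for all $n\ge0$.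 *)

(* Defs.v *)
From HB Require Import structures.
From mathcomp Require Import all_boot all_order all_algebra.
From mathcomp Require Import boolp.

Set Implicit Arguments.
Unset Strict Implicit.
Unset Printing Implicit Defensive.

Import GRing.Theory.
Local Open Scope ring_scope.
Local Open Scope quotient_scope.

(* Right modules over A are left modules over the converse ring A^c. *)
Section ConverseAlgebra.
Variables (K : fieldType) (A : algType K).
HB.instance Definition _ := GRing.Zmodule_isLmodule.Build K A^c
  (@scalerA K A) (@scale1r K A) (@scalerDr K A) (@scalerDl K A).
Fact converse_scalerAl (a : K) (u v : A^c) : a *: (u * v) = (a *: u) * v.
Proof. exact: (scalerAr a (v:A) (u:A)). Qed.
HB.instance Definition _ :=
  GRing.Lmodule_isLalgebra.Build K (A^c) converse_scalerAl.

Fact converse_scalerAr (a : K) (u v : A^c) : a *: (u * v) = u * (a *: v).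
Proof. exact: (scalerAl a (v:A) u). Qed.
HB.instance Definition _ :=
  GRing.Lalgebra_isAlgebra.Build K (A^c) converse_scalerAr.
End ConverseAlgebra.

Section RingModules.
Variable A : nzRingType.

Definition projective (P : lmodType A) : Prop :=
  forall (M N : lmodType A) (p : {linear M -> N}) (f : {linear P -> N}),
    (forall y, exists x, p x = y) ->
    exists h : {linear P -> M}, forall x, p (h x) = f x.

Definition injective_module (E : lmodType A) : Prop :=
  forall (M N : lmodType A) (i : {linear M -> N}) (f : {linear M -> E}),
    injective i -> exists h : {linear N -> E}, forall x, h (i x) = f x.

End RingModules.

Definition selfinjective (A : nzRingType) : Prop :=
  injective_module (A^o : lmodType A) /\
  injective_module ((A^c)^o : lmodType (A^c)).

(* A positively graded, locally finite algebra B = (+)_(i >= 0) B_i. The      *)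
(* internal direct sum is given by the projections pr i : B -> B_i, so that   *)
(* B_i is the set of b such that pr i b = b.                                  *)
Record galg (K : fieldType) := Galg {
  galg_sort :> algType K;
  pr : nat -> {linear galg_sort -> galg_sort};
  pr_pr : forall i j b, pr i (pr j b) = if i == j then pr j b else 0;
  pr_sum : forall b, exists n, b = \sum_(i < n) pr i b;
  pr_mul : forall i j a b,
    pr i a = a -> pr j b = b -> pr (i + j) (a * b) = a * b;
  pr_one : pr 0 1 = 1;
  pr_findim : forall i, exists (n : nat) (e : 'I_n -> galg_sort),
    forall b, exists c : 'I_n -> K, pr i b = \sum_(t < n) c t *: e t }.

Section Opposite.
Variables (K : fieldType) (B : galg K).

Fact op_pr_linear i : linear (pr B i : B^c -> B^c).
Proof. by move=> a u v; exact: (@linearP K B B _ (pr B i) a u v). Qed.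
Definition op_pr (i : nat) : {linear B^c -> B^c} :=
  HB.pack (pr B i : B^c -> B^c)
    (GRing.isLinear.Build K (B^c) (B^c) *:%R _ (op_pr_linear i)).

Fact op_pr_mul i j (a b : B^c) :
  op_pr i a = a -> op_pr j b = b -> op_pr (i + j) (a * b) = a * b.
Proof. by move=> ha hb; rewrite addnC; exact: (@pr_mul K B j i b a). Qed.

Definition op : galg K :=
  @Galg K (B^c : algType K) op_pr (@pr_pr K B) (@pr_sum K B) op_pr_mul
    (@pr_one K B) (@pr_findim K B).
End Opposite.

Section Components.
Variables (K : fieldType) (B : galg K).

(* B_j for an arbitrary integer j, with B_j = 0 for j < 0 *)
Definition homog (j : int) : {pred B} :=
  fun b => if j is Posz n then pr B n b == b else b == 0.

Fact homog_submod j : GRing.subsemimod_closed (homog j).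
Proof.
split; last first.
  move=> a u; rewrite !unfold_in; case: j => n /eqP hu; last by rewrite hu scaler0.
  by rewrite linearZ /= hu.
split; first by rewrite unfold_in; case: j => n //; rewrite linear0.
move=> u v; rewrite !unfold_in.
by case: j => n /eqP hu /eqP hv; rewrite ?linearD /= ?hu ?hv ?addr0.
Qed.
HB.instance Definition _ j := GRing.isSubmodClosed.Build K B (homog j)
  (homog_submod j).

Fact homog_subalg : GRing.subsemialg_closed (homog 0).
Proof.
split; [|exact: (homog_submod 0).1|exact: (homog_submod 0).2|].
  by rewrite unfold_in pr_one.
move=> u v; rewrite !unfold_in => /eqP hu /eqP hv.
by rewrite (pr_mul (i := 0) (j := 0)).
Qed.

Fact homogM (i j k : int) : i + j = k ->
  forall a b, a \in homog i -> b \in homog j -> a * b \in homog k.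
Proof.
move=> <- a b.
case: i => i; last by rewrite [a \in _]unfold_in => /eqP-> _; rewrite mul0r rpred0.
case: j => j; last first.
  by rewrite [b \in _]unfold_in => _ /eqP->; rewrite mulr0 rpred0.
by rewrite !unfold_in => /eqP ha /eqP hb; rewrite pr_mul.
Qed.

Definition comp (j : int) : Type := {b : B | b \in homog j}.
HB.instance Definition _ j := SubChoice.on (comp j).
HB.instance Definition _ j := [SubChoice_isSubZmodule of comp j by <:].

Fact homog1 : 1 \in homog 0. Proof. by case: homog_subalg. Qed.
Definition cone : comp 0 := exist _ 1 homog1.

Definition cmul (i j k : int) (e : i + j = k) (a : comp i) (b : comp j) : comp k :=
  exist _ (val a * val b) (homogM e (valP a) (valP b)).

(* S = B_0 *)
Definition deg0 : Type := {b : B | b \in homog 0}.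
HB.instance Definition _ := SubChoice.on deg0.
HB.instance Definition _ := GRing.SubChoice_isSubAlgebra.Build K B
  (fun b => b \in homog 0) deg0 homog_subalg.

Fact pr0_homog b : pr B 0 b \in homog 0.
Proof. by rewrite unfold_in pr_pr. Qed.

(* B -> B / B_(>= 1) = S *)
Definition to_deg0 (b : B) : deg0 := exist _ (pr B 0 b) (pr0_homog b).

Fact to_deg0D : {morph to_deg0 : a b / a + b}.
Proof. by move=> a b; apply: val_inj; rewrite /= linearD. Qed.

Fact to_deg0_homog j b : b \in homog j -> j != 0 -> to_deg0 b = 0.
Proof.
move=> hb hj; apply: val_inj => /=; move: hb hj; rewrite unfold_in.
case: j => n /eqP hb hj; last by rewrite hb linear0.
by case: n hb hj => // n <- _; rewrite pr_pr.
Qed.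

Fact pr0M i j a b :
  a \in homog i -> b \in homog j -> pr B 0 (a * b) = pr B 0 a * pr B 0 b.
Proof.
case: i => i; last by rewrite [a \in _]unfold_in => /eqP-> _; rewrite mul0r !linear0 mul0r.
case: j => j; last by rewrite [b \in _]unfold_in => _ /eqP->; rewrite mulr0 !linear0 mulr0.
rewrite !unfold_in => /eqP ha /eqP hb.
rewrite -(pr_mul ha hb) pr_pr -[in RHS]ha -[in RHS]hb !pr_pr.
case: i ha => [|i] ha; last by rewrite mul0r.
case: j hb => [|j] hb; last by rewrite mulr0.
by rewrite pr_mul // ?ha ?hb.
Qed.

(* B_j as a left S-module *)
Definition scomp (j : int) : Type := comp j.
HB.instance Definition _ j := GRing.Zmodule.on (scomp j).

Definition sact j (s : deg0) (b : scomp j) : scomp j :=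
  cmul (add0r j) (s : comp 0) b.

Fact sactA j (s t : deg0) (b : scomp j) : sact s (sact t b) = sact (s * t) b.
Proof. by apply: val_inj; rewrite /= mulrA. Qed.
Fact sact1 j : left_id 1 (@sact j).
Proof. by move=> b; apply: val_inj; rewrite /= mul1r. Qed.
Fact sactDr j : right_distributive (@sact j) +%R.
Proof. by move=> s b c; apply: val_inj; rewrite /= mulrDr. Qed.
Fact sactDl j (b : scomp j) : {morph (@sact j)^~ b : s t / s + t}.
Proof. by move=> s t; apply: val_inj; rewrite /= mulrDl. Qed.
HB.instance Definition _ j := GRing.Zmodule_isLmodule.Build deg0 (scomp j)
  (@sactA j) (@sact1 j) (@sactDr j) (@sactDl j).

End Components.

(* D(A) = Hom_K(A, K), with its left A-action (a f)(x) = f (x a).             *)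
Section KDual.
Variables (K : fieldType) (A : algType K).

Definition kdual : Type := {scalar A}.
HB.instance Definition _ := gen_eqMixin kdual.
HB.instance Definition _ := gen_choiceMixin kdual.
Identity Coercion kdual_scalar : kdual >-> GRing.Linear.type.

Fact kdualP (f g : kdual) : (forall x, f x = g x) -> f = g.
Proof.
case: f g => f [[hf1] [hf2]] [g [[hg1] [hg2]]] /= /funext efg; subst g.
by congr GRing.Linear.Pack; congr GRing.Linear.Class; f_equal; exact: Prop_irrelevance.
Qed.

Definition kdual_add (f g : kdual) : kdual := f \+ g.
Definition kdual_opp (f : kdual) : kdual := \- f.
Definition kdual_zero : kdual := \0.

Fact kdual_addA : associative kdual_add.
Proof. by move=> f g h; apply: kdualP => x; rewrite /= addrA. Qed.
Fact kdual_addC : commutative kdual_add.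
Proof. by move=> f g; apply: kdualP => x; rewrite /= addrC. Qed.
Fact kdual_add0 : left_id kdual_zero kdual_add.
Proof. by move=> f; apply: kdualP => x; rewrite /= add0r. Qed.
Fact kdual_addN : left_inverse kdual_zero kdual_opp kdual_add.
Proof. by move=> f; apply: kdualP => x; rewrite /= addNr. Qed.
HB.instance Definition _ := GRing.isZmodule.Build kdual
  kdual_addA kdual_addC kdual_add0 kdual_addN.

Fact kdual_act_scalar (a : A) (f : kdual) : scalar (fun x => f (x * a)).
Proof. by move=> c x y; rewrite mulrDl -scalerAl linearP. Qed.
Definition kdual_act (a : A) (f : kdual) : kdual :=
  HB.pack (fun x => f (x * a))
    (GRing.isLinear.Build K A K *%R _ (kdual_act_scalar a f)).

Fact kdual_actA a b f : kdual_act a (kdual_act b f) = kdual_act (a * b) f.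
Proof. by apply: kdualP => x; rewrite /= mulrA. Qed.
Fact kdual_act1 : left_id 1 kdual_act.
Proof. by move=> f; apply: kdualP => x; rewrite /= mulr1. Qed.
Fact kdual_actDr : right_distributive kdual_act +%R.
Proof. by move=> a f g; apply: kdualP. Qed.
Fact kdual_actDl f : {morph kdual_act^~ f : a b / a + b}.
Proof. by move=> a b; apply: kdualP => x; rewrite /= mulrDr linearD. Qed.
HB.instance Definition _ := GRing.Zmodule_isLmodule.Build A kdual
  kdual_actA kdual_act1 kdual_actDr kdual_actDl.

End KDual.

(* A graded left B-module is a Z-indexed family M_j with an action            *)
(* B_i x M_j -> M_(i + j). The target degree is an index k with a proof of    *)
(* i + j = k (unique, since int has decidable equality), so that the axioms   *)
(* need no transport along equalities of degrees.                             *)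
Section GradedModules.
Variables (K : fieldType) (B : galg K).

Record graded_action (M : int -> zmodType)
    (act : forall i j k : int, i + j = k -> comp B i -> M j -> M k) : Prop :=
  GradedAction {
    act_addr : forall (i j k : int) (e : i + j = k) b, {morph act i j k e b : x y / x + y};
    act_addl : forall (i j k : int) (e : i + j = k) x,
      {morph (fun b => act i j k e b x) : a b / a + b};
    act_one : forall (j : int) (e : 0 + j = j) x, act 0 j j e (cone B) x = x;
    act_mul : forall (i j k ij jk l : int) (e1 : i + j = ij) (e2 : ij + k = l)
        (e3 : j + k = jk) (e4 : i + jk = l) a b x,
      act ij k l e2 (cmul e1 a b) x = act i jk l e4 a (act j k jk e3 b x) }.

Record gmod := Gmod {
  gpart :> int -> zmodType;
  gact : forall i j k : int, i + j = k -> comp B i -> gpart j -> gpart k;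
  gactP : graded_action gact }.

Record gmor (M N : gmod) := Gmor {
  gfun :> forall j, M j -> N j;
  gfunD : forall j, {morph @gfun j : x y / x + y};
  gfun_act : forall (i j k : int) (e : i + j = k) b x,
    gfun (gact e b x) = gact e b (gfun x) }.
Arguments gfun {M N} _ j _.

(* N(n)_i = N_(i + n) *)
Fact shift_eq (i j k n : int) : i + j = k -> i + (j + n) = k + n.
Proof. by move=> <-; rewrite addrA. Qed.

Fact shiftP (N : gmod) (n : int) :
  @graded_action (fun i => N (i + n))
    (fun i j k e => gact (shift_eq n e)).
Proof.
case: (gactP N) => aDr aDl a1 aM; split=> *; [exact: aDr|exact: aDl| |exact: aM].
exact: a1.
Qed.
Definition shift (N : gmod) (n : int) : gmod := Gmod (shiftP N n).

Definition gsurj (M N : gmod) (f : gmor M N) : Prop :=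
  forall j y, exists x, f j x = y.
Definition ginj (M N : gmod) (f : gmor M N) : Prop := forall j, injective (f j).
Definition gexact (M N P : gmod) (f : gmor M N) (g : gmor N P) : Prop :=
  forall j y, g j y = 0 <-> exists x, f j x = y.
Definition gzero (M : gmod) : Prop := forall j (x : M j), x = 0.
Definition gisom (M N : gmod) : Prop :=
  exists f : gmor M N, forall j, bijective (f j).

Definition gprojective (P : gmod) : Prop :=
  forall (M N : gmod) (p : gmor M N) (f : gmor P N),
    gsurj p -> exists h : gmor P M, forall j x, p j (h j x) = f j x.
Definition ginjective (E : gmod) : Prop :=
  forall (M N : gmod) (i : gmor M N) (f : gmor M E),
    ginj i -> exists h : gmor N E, forall j x, h j (i j x) = f j x.

(* ... -> P_1 -> P_0 -> M -> 0 *)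
Record proj_res (M : gmod) := ProjRes {
  pterm :> nat -> gmod;
  pdiff : forall n, gmor (pterm n.+1) (pterm n);
  paug : gmor (pterm 0) M;
  pterm_proj : forall n, gprojective (pterm n);
  paug_surj : gsurj paug;
  pexact0 : gexact (pdiff 0) paug;
  pexact : forall n, gexact (pdiff n.+1) (pdiff n) }.

(* 0 -> M -> I^0 -> I^1 -> ... *)
Record inj_res (M : gmod) := InjRes {
  iterm :> nat -> gmod;
  idiff : forall n, gmor (iterm n) (iterm n.+1);
  iaug : gmor M (iterm 0);
  iterm_inj : forall n, ginjective (iterm n);
  iaug_inj : ginj iaug;
  iexact0 : gexact iaug (idiff 0);
  iexact : forall n, gexact (idiff n) (idiff n.+1) }.

Definition pdim_le (M : gmod) (d : nat) : Prop :=
  exists P : proj_res M, forall n, (d < n)%N -> gzero (P n).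
Definition injdim_le (M : gmod) (d : nat) : Prop :=
  exists I : inj_res M, forall n, (d < n)%N -> gzero (I n).
Definition pdim_eq (M : gmod) (d : nat) : Prop :=
  pdim_le M d /\ forall n, pdim_le M n -> (d <= n)%N.
Definition injdim_eq (M : gmod) (d : nat) : Prop :=
  injdim_le M d /\ forall n, injdim_le M n -> (d <= n)%N.

Definition generated_in (M : gmod) (n : int) : Prop :=
  forall (i k : int) (e : i + n = k) (x : M k), exists (r : nat)
    (b : 'I_r -> comp B i) (m : 'I_r -> M n), x = \sum_(t < r) gact e (b t) (m t).

(* The surjection P_0 -> M makes a Koszul module M generated in degree 0. *)
Definition koszul_module (M : gmod) : Prop :=
  exists P : proj_res M, forall n : nat, generated_in (P n) n.

(* A left S-module M, viewed through B -> S as a graded left B-module         *)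
(* concentrated in degree 0. Each graded piece is cut out of M itself.        *)
Section Concentrated.
Variable M : lmodType (deg0 B).

Definition conc_pred (j : int) : {pred M} := fun x => (j == 0) || (x == 0).

Fact conc_zmod j : zmod_closed (conc_pred j).
Proof.
split=> [|x y]; rewrite !unfold_in ?eqxx ?orbT //.
by case: (j == 0) => //= /eqP-> /eqP->; rewrite subr0.
Qed.
HB.instance Definition _ j := GRing.isZmodClosed.Build M (conc_pred j)
  (conc_zmod j).

Definition conc_part (j : int) : Type := {x : M | x \in conc_pred j}.
HB.instance Definition _ j := SubChoice.on (conc_part j).
HB.instance Definition _ j := [SubChoice_isSubZmodule of conc_part j by <:].

Fact conc_act_subproof (i j k : int) (e : i + j = k) (b : comp B i) (x : conc_part j) :
  to_deg0 (val b) *: val x \in conc_pred k.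
Proof.
case: x => x hx /=; rewrite unfold_in -e; move: hx; rewrite unfold_in.
case/orP => /eqP->; last by rewrite scaler0 eqxx orbT.
rewrite addr0; case: eqP => //= /eqP hi.
by rewrite (to_deg0_homog (valP b) hi) scale0r.
Qed.
Definition conc_act (i j k : int) (e : i + j = k) (b : comp B i) (x : conc_part j) :
    conc_part k := exist (fun y => y \in conc_pred k) _ (conc_act_subproof e b x).

Fact conc_actP : @graded_action conc_part conc_act.
Proof.
split=> [i j k e b x y|i j k e x a b|j e x|i j k ij jk l e1 e2 e3 e4 a b x];
  apply: val_inj => /=.
- by rewrite scalerDr.
- by rewrite to_deg0D scalerDl.
- have -> : to_deg0 (1 : B) = 1 by apply: val_inj; rewrite /= pr_one.
  by rewrite scale1r.
rewrite scalerA; congr (_ *: _); apply: val_inj => /=.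
exact: (pr0M (valP a) (valP b)).
Qed.
Definition conc : gmod := Gmod conc_actP.
End Concentrated.

Definition gS : gmod := conc ((deg0 B)^o : lmodType (deg0 B)).
Definition gDS : gmod := conc (kdual (deg0 B) : lmodType (deg0 B)).

End GradedModules.

Section HomGroup.
Variables (K : fieldType) (B : galg K) (M N : gmod B).

HB.instance Definition _ := gen_eqMixin (gmor M N).
HB.instance Definition _ := gen_choiceMixin (gmor M N).

Fact gmorP (f g : gmor M N) : (forall j x, f j x = g j x) -> f = g.
Proof.
case: f g => f hf hf' [g hg hg'] /= efg.
have {}efg : f = g.
  by apply: functional_extensionality_dep => j; apply/funext => x; exact: efg.
by subst g; congr Gmor; exact: Prop_irrelevance.
Qed.

Fact gact0 (L : gmod B) (i j k : int) (e : i + j = k) b : gact e b (0 : L j) = 0.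
Proof. by apply: (addrI (gact e b 0)); rewrite -(act_addr (gactP L)) !addr0. Qed.
Fact gactN (L : gmod B) (i j k : int) (e : i + j = k) b (x : L j) :
  gact e b (- x) = - gact e b x.
Proof.
by apply: (addrI (gact e b x)); rewrite -(act_addr (gactP L)) !subrr gact0.
Qed.

Definition gmor_zero : gmor M N :=
  @Gmor K B M N (fun j x => 0) (fun j x y => esym (addr0 0))
    (fun i j k e b x => esym (gact0 N e b)).

Fact gmor_addD (f g : gmor M N) j :
  {morph (fun x => f j x + g j x) : x y / x + y}.
Proof. by move=> x y; rewrite !gfunD addrACA. Qed.
Fact gmor_add_act (f g : gmor M N) (i j k : int) (e : i + j = k) b x :
  f k (gact e b x) + g k (gact e b x) = gact e b (f j x + g j x).
Proof. by rewrite !gfun_act (act_addr (gactP N)). Qed.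
Definition gmor_add (f g : gmor M N) : gmor M N :=
  Gmor (gmor_addD f g) (gmor_add_act f g).

Fact gmor_oppD (f : gmor M N) j : {morph (fun x => - f j x) : x y / x + y}.
Proof. by move=> x y; rewrite gfunD opprD. Qed.
Fact gmor_opp_act (f : gmor M N) (i j k : int) (e : i + j = k) b x :
  - f k (gact e b x) = gact e b (- f j x).
Proof. by rewrite gfun_act gactN. Qed.
Definition gmor_opp (f : gmor M N) : gmor M N :=
  Gmor (gmor_oppD f) (gmor_opp_act f).

Fact gmor_addA : associative gmor_add.
Proof. by move=> f g h; apply: gmorP => j x; rewrite /= addrA. Qed.
Fact gmor_addC : commutative gmor_add.
Proof. by move=> f g; apply: gmorP => j x; rewrite /= addrC. Qed.
Fact gmor_add0 : left_id gmor_zero gmor_add.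
Proof. by move=> f; apply: gmorP => j x; rewrite /= add0r. Qed.
Fact gmor_addN : left_inverse gmor_zero gmor_opp gmor_add.
Proof. by move=> f; apply: gmorP => j x; rewrite /= addNr. Qed.
HB.instance Definition _ := GRing.isZmodule.Build (gmor M N)
  gmor_addA gmor_addC gmor_add0 gmor_addN.

End HomGroup.

Section Comp.
Variables (K : fieldType) (B : galg K) (L M N : gmod B).

Fact gcompD (g : gmor M N) (f : gmor L M) j :
  {morph (fun x => g j (f j x)) : x y / x + y}.
Proof. by move=> x y; rewrite !gfunD. Qed.
Fact gcomp_act (g : gmor M N) (f : gmor L M) (i j k : int) (e : i + j = k) b x :
  g k (f k (gact e b x)) = gact e b (g j (f j x)).
Proof. by rewrite !gfun_act. Qed.
Definition gcomp (g : gmor M N) (f : gmor L M) : gmor L N :=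
  Gmor (gcompD g f) (gcomp_act g f).

Fact gcompBl (g h : gmor M N) (f : gmor L M) :
  gcomp (g - h) f = gcomp g f - gcomp h f.
Proof. exact: gmorP. Qed.
Fact gcomp0l (f : gmor L M) : gcomp (0 : gmor M N) f = 0.
Proof. exact: gmorP. Qed.
End Comp.

(* Graded bimodules: commuting left actions of B and of B'. A (B, op B)-      *)
(* bimodule is a B-bimodule in the usual sense.                               *)
Section Bimodules.
Variable K : fieldType.

Record gbimod (B B' : galg K) := Gbimod {
  bpart : int -> zmodType;
  bact1 : forall i j k : int, i + j = k -> comp B i -> bpart j -> bpart k;
  bact2 : forall i j k : int, i + j = k -> comp B' i -> bpart j -> bpart k;
  bact1P : graded_action bact1;
  bact2P : graded_action bact2;
  bactC : forall (i j k ik jk l : int) (e1 : j + k = jk) (e2 : i + jk = l)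
      (e3 : i + k = ik) (e4 : j + ik = l) a b x,
    bact1 e2 a (bact2 e1 b x) = bact2 e4 b (bact1 e3 a x) }.

Definition bmod1 B B' (N : gbimod B B') : gmod B := Gmod (bact1P N).

Definition bswap B B' (N : gbimod B B') : gbimod B' B :=
  @Gbimod B' B (bpart N) _ _ (bact2P N) (bact1P N)
    (fun i j k ik jk l e1 e2 e3 e4 a b x =>
       esym (bactC (g := N) e3 e4 e1 e2 b a x)).

(* B itself: B acts by left, op B by right multiplication *)
Section Regular.
Variable B : galg K.

Definition rmul (i j k : int) (e : i + j = k) (b : comp (op B) i)
    (x : comp B j) : comp B k :=
  cmul (etrans (addrC j i) e) x (b : comp B i).

Fact reg_lP : @graded_action K B (comp B : int -> zmodType) (@cmul K B).
Proof.
split=> [i j k e b x y|i j k e x a b|j e x|i j k ij jk l e1 e2 e3 e4 a b x];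
  apply: (@val_inj _ _ (comp B _)) => /=.
- by rewrite mulrDr.
- by rewrite mulrDl.
- by rewrite mul1r.
- by rewrite mulrA.
Qed.
Fact reg_rP : @graded_action K (op B) (comp B : int -> zmodType) rmul.
Proof.
split=> [i j k e b x y|i j k e x a b|j e x|i j k ij jk l e1 e2 e3 e4 a b x];
  apply: (@val_inj _ _ (comp B _)) => /=.
- by rewrite mulrDl.
- exact: mulrDr.
- exact: mulr1.
- exact: (mulrA (_ : B)).
Qed.
Fact reg_C (i j k ik jk l : int) (e1 : j + k = jk) (e2 : i + jk = l)
    (e3 : i + k = ik) (e4 : j + ik = l) (a : comp B i) (b : comp (op B) j)
    (x : comp B k) :
  cmul e2 a (rmul e1 b x) = rmul e4 b (cmul e3 a x).
Proof. by apply: val_inj; rewrite /= mulrA. Qed.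
Definition reg : gbimod B (op B) := Gbimod reg_lP reg_rP reg_C.
End Regular.

End Bimodules.

(* The action of B' on Hom(L, N): an element b of B'_i sends f in Hom(L, N(j)) *)
(* to b f in Hom(L, N(i + j)).                                                *)
Section Post.
Variables (K : fieldType) (B B' : galg K) (N : gbimod B B').

Fact post_eq (i j k u : int) : i + j = k -> i + (u + j) = u + k.
Proof. by move=> <-; rewrite addrCA. Qed.

Section Def.
Variables (L : gmod B) (i j k : int) (e : i + j = k) (b : comp B' i).

Fact post_addD (f : gmor L (shift (bmod1 N) j)) u :
  {morph (fun x => bact2 (g := N) (post_eq u e) b (f u x)) : x y / x + y}.
Proof. by move=> x y; rewrite gfunD (act_addr (bact2P N)). Qed.
Fact post_act (f : gmor L (shift (bmod1 N) j)) (p q r : int) (e' : p + q = r) a x :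
  bact2 (g := N) (post_eq r e) b (f r (gact e' a x)) =
  gact (g := shift (bmod1 N) k) e' a (bact2 (g := N) (post_eq q e) b (f q x)).
Proof. by rewrite gfun_act /=; apply/esym/bactC. Qed.
Definition post (f : gmor L (shift (bmod1 N) j)) : gmor L (shift (bmod1 N) k) :=
  @Gmor K B L (shift (bmod1 N) k) _ (post_addD f) (post_act f).
End Def.

Fact post_comp (L L' : gmod B) (i j k : int) (e : i + j = k) b
    (f : gmor L (shift (bmod1 N) j)) (g : gmor L' L) :
  gcomp (post e b f) g = post e b (gcomp f g).
Proof. exact: gmorP. Qed.
Fact postD (L : gmod B) (i j k : int) (e : i + j = k) b :
  {morph @post L i j k e b : f g / f + g}.
Proof. by move=> f g; apply: gmorP => u x; rewrite /= (act_addr (bact2P N)). Qed.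
Fact postB (L : gmod B) (i j k : int) (e : i + j = k) b :
  {morph @post L i j k e b : f g / f - g}.
Proof. by move=> f g; apply: (addIr (post e b g)); rewrite -postD !subrK. Qed.
Fact post0 (L : gmod B) (i j k : int) (e : i + j = k) b : @post L i j k e b 0 = 0.
Proof. by apply: (addrI (post e b 0)); rewrite -postD !addr0. Qed.
Fact postDl (L : gmod B) (i j k : int) (e : i + j = k) f :
  {morph (fun b => @post L i j k e b f) : a b / a + b}.
Proof. by move=> a b; apply: gmorP => u x; rewrite /= (act_addl (bact2P N)). Qed.
Fact post1 (L : gmod B) (j : int) (e : 0 + j = j) f :
  @post L 0 j j e (cone B') f = f.
Proof. by apply: gmorP => u x; rewrite /= (act_one (bact2P N)). Qed.
Fact postM (L : gmod B) (i j k ij jk l : int) (e1 : i + j = ij)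
    (e2 : ij + k = l) (e3 : j + k = jk) (e4 : i + jk = l) a b f :
  @post L ij k l e2 (cmul e1 a b) f = post e4 a (post e3 b f).
Proof. by apply: gmorP => u x; exact: (act_mul (bact2P N)). Qed.
End Post.

(* Ext^n_B(M, N) is computed from a projective resolution P of M:             *)
(* Ext^n_B(M, N)_j is the n-th cohomology of the complex                      *)
(* Hom(P_0, N(j)) -> Hom(P_1, N(j)) -> ..., and B' acts through N.            *)
Section Ext.
Variables (K : fieldType) (B B' : galg K) (M : gmod B) (P : proj_res M).

Definition is_coboundary (L : gmod B) (n : nat) : gmor (P n) L -> Prop :=
  match n as m return gmor (P m) L -> Prop with
  | 0 => fun f => f = 0
  | m.+1 => fun f => exists h : gmor (P m) L, f = gcomp h (pdiff P m)
  end.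

Fact is_coboundary0 L n : is_coboundary (0 : gmor (P n) L).
Proof. by case: n => //= n; exists 0; rewrite gcomp0l. Qed.
Fact is_coboundaryB L n (f g : gmor (P n) L) :
  is_coboundary f -> is_coboundary g -> is_coboundary (f - g).
Proof.
case: n f g => [|n] f g /=; first by move=> -> ->; rewrite subr0.
by move=> [h ->] [h' ->]; exists (h - h'); rewrite gcompBl.
Qed.

Variables (N : gbimod B B') (n : nat).

Definition cochain (j : int) : Type := gmor (P n) (shift (bmod1 N) j).
HB.instance Definition _ j := GRing.Zmodule.on (cochain j).

Definition cocycle_pred (j : int) : {pred cochain j} :=
  fun f => gcomp f (pdiff P n) == 0.

Fact cocycle_zmod j : zmod_closed (@cocycle_pred j).
Proof.
split=> [|f g]; rewrite !unfold_in; first by rewrite gcomp0l.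
by move=> /eqP hf /eqP hg; rewrite gcompBl hf hg subr0.
Qed.
HB.instance Definition _ j := GRing.isZmodClosed.Build (cochain j)
  (@cocycle_pred j) (cocycle_zmod j).

Definition cocycle (j : int) : Type := {f : cochain j | f \in @cocycle_pred j}.
HB.instance Definition _ j := SubChoice.on (cocycle j).
HB.instance Definition _ j := [SubChoice_isSubZmodule of cocycle j by <:].

Definition coboundary (j : int) : {pred cocycle j} :=
  fun f => `[< is_coboundary (val f) >].

Fact coboundary_zmod j : zmod_closed (@coboundary j).
Proof.
split=> [|f g]; rewrite !unfold_in; first by apply/asboolP/is_coboundary0.
by move=> /asboolP hf /asboolP hg; apply/asboolP/is_coboundaryB.
Qed.
HB.instance Definition _ j := GRing.isZmodClosed.Build (cocycle j)
  (@coboundary j) (coboundary_zmod j).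

Definition ext_part (j : int) : zmodType := Quotient.quot (@coboundary j).

Fact post_cocycle (i j k : int) (e : i + j = k) b (f : cocycle j) :
  post e b (val f) \in @cocycle_pred k.
Proof.
case: f => f /=; rewrite !unfold_in => /eqP hf.
by rewrite post_comp hf post0.
Qed.
Definition cocycle_act (i j k : int) (e : i + j = k) (b : comp B' i)
    (f : cocycle j) : cocycle k :=
  exist (fun g => g \in @cocycle_pred k) _ (post_cocycle e b f).

Definition ext_act (i j k : int) (e : i + j = k) (b : comp B' i)
    (x : ext_part j) : ext_part k :=
  \pi_(ext_part k) (cocycle_act e b (repr x)).

Fact is_coboundary_post (m : nat) (i j k : int) (e : i + j = k) b
    (f : gmor (P m) (shift (bmod1 N) j)) :
  is_coboundary f -> is_coboundary (post e b f).
Proof.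
case: m f => [|m] f /=; first by move=> ->; rewrite post0.
by move=> [h ->]; exists (post e b h); rewrite post_comp.
Qed.

Fact ext_eqP j (f g : cocycle j) :
  is_coboundary (val (f - g)) -> \pi_(ext_part j) f = \pi_(ext_part j) g.
Proof. by move=> h; apply/eqP; rewrite -Quotient.idealrBE; apply/asboolP. Qed.

Fact ext_actE (i j k : int) (e : i + j = k) b (f : cocycle j) :
  ext_act e b (\pi_(ext_part j) f) = \pi_(ext_part k) (cocycle_act e b f).
Proof.
apply: ext_eqP; set g := repr _.
have hg : is_coboundary (val (g - f)).
  by apply/asboolP; change (g - f \in @coboundary j);
     rewrite Quotient.idealrBE reprK.
by rewrite /= -postB; apply: is_coboundary_post.
Qed.

Fact ext_piD j (f g : cocycle j) :
  \pi_(ext_part j) (f + g) = \pi_(ext_part j) f + \pi_(ext_part j) g.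
Proof. exact: (raddfD (\pi_(Quotient.quot (@coboundary j)))). Qed.

Fact ext_reprK j (x : ext_part j) : x = \pi_(ext_part j) (repr x).
Proof. by rewrite reprK. Qed.

Fact ext_actP : @graded_action K B' ext_part ext_act.
Proof.
split=> [i j k e b x y|i j k e x a b|j e x|i j k ij jk l e1 e2 e3 e4 a b x].
- rewrite (ext_reprK x) (ext_reprK y) -ext_piD !ext_actE -ext_piD.
  by congr (\pi_(ext_part k) _); apply: val_inj; exact: postD.
- rewrite (ext_reprK x) !ext_actE -ext_piD.
  by congr (\pi_(ext_part k) _); apply: val_inj; exact: postDl.
- rewrite (ext_reprK x) ext_actE.
  by congr (\pi_(ext_part j) _); apply: val_inj; exact: post1.
rewrite (ext_reprK x) !ext_actE.
by congr (\pi_(ext_part l) _); apply: val_inj; exact: postM.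
Qed.

Definition gExt : gmod B' := Gmod ext_actP.

End Ext.

(* The graded Ext of a module is independent, up to isomorphism, of the       *)
(* projective resolution that computes it.                                    *)
Definition ext_isom (K : fieldType) (B B' : galg K) (n : nat) (M : gmod B)
    (N : gbimod B B') (E : gmod B') : Prop :=
  exists P : proj_res M, gisom (gExt P N n) E.
Definition ext_zero (K : fieldType) (B B' : galg K) (n : nat) (M : gmod B)
    (N : gbimod B B') : Prop :=
  exists P : proj_res M, gzero (gExt P N n).

Section ArtinSchelter.
Variables (K : fieldType) (B : galg K).

(* Graded right B-modules are graded left modules over op B. Since deg0 (op B) *)
(* is the converse of the ring S, gS (op B) is S_B and gDS (op B) is D(S)_B.  *)
Definition AS_gorenstein (d : nat) (l : int) : Prop :=
  [/\ injdim_eq (bmod1 (bswap (reg B))) d /\ injdim_eq (bmod1 (reg B)) d,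
      (forall i : nat, i != d -> ext_zero i (gS (op B)) (bswap (reg B))) /\
      ext_isom d (gS (op B)) (bswap (reg B)) (shift (gDS B) l)
    & (forall i : nat, i != d -> ext_zero i (gS B) (reg B)) /\
      ext_isom d (gS B) (reg B) (shift (gDS (op B)) l)].

Definition koszul_algebra : Prop :=
  [/\ forall i : nat, (1 <= i)%N -> projective (scomp B i : lmodType (deg0 B)),
      forall i : nat, (1 <= i)%N ->
        projective (scomp (op B) i : lmodType (deg0 (op B)))
    & koszul_module (gS (op B))].

Definition standard_koszul_AS_gorenstein (d : nat) : Prop :=
  exists l : int, [/\ AS_gorenstein d l, koszul_algebra & l = d%:Z].

End ArtinSchelter.

(* Main.v *)
Require Import Defs.
From HB Require Import structures.
From mathcomp Require Import all_boot all_order all_algebra.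
From mathcomp Require Import boolp classical_sets.

(** Let P be a linear projective resolution of S_B. Its terms are finitely
generated, and Q^n = Hom_B(P_n, B) is a projective left module generated in
degree -n. The Gorenstein condition with l = d says that the complex Q has the
only cohomology D(S), in cohomological degree d and internal degree -d.

In internal degree -d there are no coboundaries in Q^d, so that D(S) is a space of
maps P_d -> B(-d). Evaluating them at generators of P_d embeds D(S) in a power of
S, and the injective module D(S) splits off: the left module D(S) is projective
([top_endomorphism]). For a finite dimensional algebra this already implies that
S is a direct summand of a power of D(S) ([kdual_projective_generates]), and by
duality both properties hold on the right too ([kdual_projective_anti],
[kdual_generates_anti]). Hence S is selfinjective on both sides.

The splitting also yields an idempotent endomorphism of P_d through which all
cocycles P_d -> B(-d) factor and which kills the boundaries. Since
Ext^i(S_B, B) = 0 for i < d it extends to an idempotent chain map eps of P, zero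
above d ([extend_endomorphism]). Its complement eta is zero on Ext(S_B, B), so
that the image of eta in Q is an exact complex, bounded on the left. As B has
injective dimension d on the left, a map from the first term of this complex to B
extends to the second term ([injdim_factor]); the second term is generated in
degree -1, and such a map of degree 0 is zero. So eta is zero on P_0, and by
linearity everywhere: P_n = 0 for n > d ([finite_linear_resolution]).

Now Q is a finite exact complex of projectives ending in D(S)(d), that is, a linear
resolution of the left module D(S) of length d ([kdual_linear_res]). On the right,
D(S) is a direct summand of a power of S_B, and a linear resolution passes to
direct summands because lifts along it are unique ([linear_res_retract]). Finally
S is a direct summand of a power of D(S) on either side and Ext^d(S, B) is not
zero, so that the projective dimension of D(S) is at least d ([pdim_ge_ext]). *)

Set Implicit Arguments.
Unset Strict Implicit.
Unset Printing Implicit Defensive.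

Import Order.TTheory GRing.Theory Num.Theory.
Local Open Scope ring_scope.
Local Open Scope quotient_scope.

(** * Finite dimensional vector spaces *)

Definition scalar_of (R : nzRingType) (V : lmodType R) (f : V -> R)
    (h : scalar f) : {scalar V} :=
  HB.pack f (GRing.isLinear.Build R V R *%R f h).
Definition linear_of (R : nzRingType) (U V : lmodType R) (f : U -> V)
    (h : linear f) : {linear U -> V} :=
  HB.pack f (GRing.isLinear.Build R U V *:%R f h).

Section FiniteSpan.
Variable K : fieldType.
Implicit Types V W : lmodType K.

Definition in_span V (I : finType) (e : I -> V) (x : V) : Prop :=
  exists c : I -> K, x = \sum_t c t *: e t.

Lemma in_span_mem V (I : finType) (e : I -> V) t : in_span e (e t).
Proof.
exists (fun s => (s == t)%:R); rewrite (bigD1 t) //= eqxx scale1r big1 ?addr0 //.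
by move=> s /negbTE->; rewrite scale0r.
Qed.

Lemma in_spanZ V (I : finType) (e : I -> V) a x : in_span e x -> in_span e (a *: x).
Proof.
move=> [c ->]; exists (fun t => a * c t); rewrite scaler_sumr.
by apply: eq_bigr => t _; rewrite scalerA.
Qed.

Lemma in_span_sum V (I : finType) (e : I -> V) (J : finType) (x : J -> V) :
  (forall s, in_span e (x s)) -> in_span e (\sum_s x s).
Proof.
move=> /choice[c hc]; exists (fun t => \sum_s c s t).
under eq_bigr do rewrite hc; rewrite exchange_big /=.
by apply: eq_bigr => t _; rewrite scaler_suml.
Qed.

(** Finite dimension is recorded by the existence of a finite spanning family:
the spaces that occur (B_0, homogeneous components of modules) come without a
chosen basis. *)
Definition finspan V : Prop := exists (r : nat) (e : 'I_r -> V), forall x, in_span e x.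

Lemma finspan_fin V (I : finType) (e : I -> V) :
  (forall x, in_span e x) -> finspan V.
Proof.
move=> he; exists #|I|, (fun t => e (enum_val t)) => x.
have [c ->] := he x; exists (fun t => c (enum_val t)).
by rewrite (reindex (@enum_val I I)) //=; apply: onW_bij; exact: enum_val_bij.
Qed.

(** A spanning family of least size is free, so that coordinates with respect
to it are unique, hence linear. *)
Lemma finspan_basis V : finspan V ->
  exists (r : nat) (e : 'I_r -> V) (c : 'I_r -> {scalar V}),
    forall x, x = \sum_t c t x *: e t.
Proof.
move=> [r0 hr0].
pose Q r := `[< exists e : 'I_r -> V, forall x, in_span e x >].
have exQ : exists r, Q r by exists r0; apply/asboolP.
have [r /asboolP[e he] rmin] := ex_minnP exQ.
have indep (a : 'I_r -> K) : \sum_t a t *: e t = 0 -> forall s, a s = 0.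
  move=> ha s; apply/eqP/negPn/negP => nas.
  case: r e he rmin a ha s nas => [|r] e he rmin a ha s nas; first by case: s nas.
  suff /rmin : Q r by rewrite ltnn.
  apply/asboolP; exists (fun t => e (lift s t)) => x; have [c hc] := he x.
  exists (fun t => c (lift s t) - c s / a s * a (lift s t)).
  have : x = \sum_t (c t - c s / a s * a t) *: e t.
    under eq_bigr do rewrite scalerBl -scalerA.
    by rewrite sumrB -scaler_sumr ha scaler0 subr0.
  by rewrite (bigD1_ord s) //= divfK // subrr scale0r add0r.
have [c hc] := choice he.
have uniq (a b : 'I_r -> K) :
    \sum_t a t *: e t = \sum_t b t *: e t -> forall s, a s = b s.
  move=> hab s; apply/eqP; rewrite -subr_eq0; apply/eqP.
  apply: (indep (fun t => a t - b t)).
  by under eq_bigr do rewrite scalerBl; rewrite sumrB hab subrr.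
have clin t : scalar (fun x => c x t).
  move=> a x y; apply: (uniq _ (fun t => a * c x t + c y t)); rewrite -hc.
  under eq_bigr do rewrite scalerDl -scalerA.
  by rewrite big_split /= -scaler_sumr -!hc.
exists r, e, (fun t => scalar_of (clin t)).
by move=> x; rewrite [LHS]hc.
Qed.

Lemma finspan_coord V : finspan V ->
  exists (m : nat) (phi : {linear V -> 'rV[K]_m}), injective phi.
Proof.
move=> /finspan_basis[m [e [c hc]]].
have lin : linear (fun x : V => \row_t c t x).
  by move=> a x y; apply/rowP => t; rewrite !mxE linearP.
exists m, (linear_of lin).
move=> x y /rowP /= hxy; rewrite (hc x) (hc y).
by apply: eq_bigr => t _; have := hxy t; rewrite !mxE => ->.
Qed.

(** Choose a finite family of V whose image in coordinates has maximal rank: a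
vector outside its span would raise the rank. *)
Lemma finspan_inj V W (phi : {linear V -> W}) :
  injective phi -> finspan W -> finspan V.
Proof.
move=> phi_inj /finspan_coord[m [psi psi_inj]].
pose A r (v : 'I_r -> V) : 'M[K]_(r, m) := \matrix_t psi (phi (v t)).
pose Q k := `[< exists r (v : 'I_r -> V), \rank (A r v) = k >].
have exQ : exists k, Q k.
  by exists (\rank (A 0 (fun=> 0))); apply/asboolP; exists 0, (fun=> 0).
have Qm k : Q k -> (k <= m)%N by move=> /asboolP[r [v <-]]; exact: rank_leq_col.
have [k /asboolP[r [v hv]] kmax] := ex_maxnP exQ Qm.
exists r, v => x.
have /submxP[c hc] : (psi (phi x) <= A r v)%MS.
  apply: contraT => nle.
  pose w (i : 'I_(r + 1)) := match split i with inl j => v j | inr _ => x end.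
  have hw : A (r + 1) w = col_mx (A r v) (psi (phi x)).
    by apply/matrixP => i j; rewrite !mxE /w; case: (split i) => t; rewrite ?mxE ?ord1.
  have : Q (\rank (A (r + 1) w)) by apply/asboolP; exists (r + 1), w.
  move=> /kmax; rewrite leqNgt -hv hw -addsmxE.
  rewrite ltn_neqAle mxrankS ?addsmxSl // andbT.
  rewrite (mxrank_leqif_sup (addsmxSl _ _)).
  by rewrite addsmx_sub submx_refl (negbTE nle).
exists (fun t => c 0 t); apply/phi_inj/psi_inj; rewrite hc.
rewrite !linear_sum mulmx_sum_row; apply: eq_bigr => t _.
by rewrite !linearZ /= rowK.
Qed.

(** If the chain never stabilised, the vectors picked in I k but not in I k.+1
would form an infinite free family: in a linear relation between them, the one
of least index is a combination of later ones and lies in the next subspace. *)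
Lemma finspan_descending V (I : nat -> V -> Prop) : finspan V ->
  (forall k x, I k.+1 x -> I k x) ->
  (forall k, I k 0) -> (forall k x y, I k x -> I k y -> I k (x + y)) ->
  (forall k a x, I k x -> I k (a *: x)) ->
  exists k, forall x, I k x -> I k.+1 x.
Proof.
move=> /finspan_coord[m [psi psi_inj]] Idec I0 ID IZ.
apply/not_existsP => nstab.
have /choice[x hx] : forall k, exists x, I k x /\ ~ I k.+1 x.
  move=> k; have /existsNP[x /not_implyP hx] := nstab k; by exists x.
pose A : 'M[K]_(m.+1, m) := \matrix_t psi (x t).
have nfree : kermx A != 0.
  by rewrite kermx_eq0 -row_leq_rank -ltnNge ltnS rank_leq_col.
have [c cK c0] : exists2 c : 'rV_m.+1, c *m A = 0 & c != 0.
  by have /rowV0Pn[c /sub_kermxP ? ?] := nfree; exists c.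
have hsum : \sum_t c 0 t *: x t = 0.
  apply: psi_inj; rewrite linear0 -cK linear_sum mulmx_sum_row.
  by apply: eq_bigr => t _; rewrite linearZ /= rowK.
have [s0 hs0] : exists s, c 0 s != 0 by have /rV0Pn := c0.
pose s := [arg min_(s < s0 | c 0 s != 0) (s : nat)].
have [cs smin] : c 0 s != 0 /\ forall t : 'I_m.+1, c 0 t != 0 -> (s <= t)%N.
  by rewrite /s; case: arg_minnP => // t ht hmin; split.
have Imono k l y : (k <= l)%N -> I l y -> I k y.
  by elim: l => [|l IHl]; rewrite leq_eqVlt => /orP[/eqP->|] // /IHl h /Idec.
apply: (hx s).2.
have -> : x s = - (c 0 s)^-1 *: \sum_(t | t != s) c 0 t *: x t.
  have := hsum; rewrite (bigD1 s) //= => /eqP; rewrite addr_eq0 => /eqP h.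
  by rewrite scaleNr -scalerN -h scalerA mulVf // scale1r.
apply: (IZ).
apply: (big_ind (I s.+1)) => [||t nts]; [exact: I0|exact: ID|].
have [->|/smin sle] := eqVneq (c 0 t) 0; first by rewrite scale0r.
apply: IZ; apply: Imono (hx t).1.
by rewrite ltn_neqAle sle andbT eq_sym.
Qed.

End FiniteSpan.

(** * The dual of an algebra *)

Section FunctionalExtension.
Variables (K : fieldType) (R : algType K).

(** Modules over a K-algebra R have no K-structure of their own here; the
scalars act through a%:A. *)
Definition kfunctional (M : lmodType R) (lam : M -> K) : Prop :=
  forall a x y, lam (a%:A *: x + y) = a * lam x + lam y.

(** Hahn-Banach without a norm. It rests on Zorn's lemma since the modules that
test injectivity may be infinite dimensional. *)
Lemma kfunctional_ext (M N : lmodType R) (i : {linear M -> N}) (lam : M -> K) :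
  injective i -> kfunctional lam ->
  exists Lam : N -> K, kfunctional Lam /\ forall x, Lam (i x) = lam x.
Proof.
move=> i_inj lamL.
pose good (G : set (N * K)) := [/\ forall x, G (i x, lam x),
  forall a p q, G p -> G q -> G (a%:A *: p.1 + q.1, a * p.2 + q.2) &
  forall c, G (0, c) -> c = 0].
(* The empty graph is admitted, as the union of the empty chain. *)
pose Q (G : set (N * K)) := (forall p, ~ G p) \/ good G.
have lam0 : lam 0 = 0.
  have := lamL 1 0 0; rewrite scaler0 addr0 mul1r => h.
  by apply: (addrI (lam 0)); rewrite addr0 -h.
have base_good : good (fun p => exists x, p = (i x, lam x)).
  split=> [x|a _ _ [x ->] [y ->]|c [x [/esym]]]; first by exists x.
    by exists (a%:A *: x + y); rewrite lamL linearP.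
  by rewrite -(linear0 i) => /i_inj-> ->.
have [F FQ Ftot|A [QA Amax]] := @Zorn_bigcup _ Q.
  have [[X0 [FX0 [p0 Xp0]]]|none] := pselect (exists X, F X /\ exists p, X p); last first.
    by left=> p [X FX Xp]; apply: none; exists X; split=> //; exists p.
  have Fgood X p : F X -> X p -> good X.
    by move=> FX Xp; have [/(_ p)|] := FQ X FX.
  right; split=> [x|a p q [X FX Xp] [Y FY Yq]|c [X FX Xc]].
  - by exists X0 => //; have [+ _ _] := Fgood X0 p0 FX0 Xp0; apply.
  - have [/(_ _ Xp) Yp|/(_ _ Yq) Xq] := Ftot _ _ FX FY.
      by exists Y => //; have [_ + _] := Fgood _ _ FY Yq; apply.
    by exists X => //; have [_ + _] := Fgood _ _ FX Xp; apply.
  - by have [_ _ +] := Fgood _ _ FX Xc; apply.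
have [Abase AL A0] : good A.
  case: QA => // Aempty; case: (Amax (fun p => exists x, p = (i x, lam x))).
    split=> [p /Aempty//|/(_ (i 0, lam 0)) h].
    by apply: (Aempty (i 0, lam 0)); apply: h; exists 0.
  by right.
have A00 : A (0, 0) by have := Abase 0; rewrite linear0 lam0.
have Atot x : exists c, A (x, c).
  apply: contrapT => hx.
  (* the graph extended to the line of x by the value 0 *)
  pose A' (p : N * K) := exists a q, A q /\ p = (a%:A *: x + q.1, q.2).
  apply: (Amax A'); first split.
  - by move=> p Ap; exists 0, p; rewrite scale0r scale0r add0r; case: p Ap.
  - move=> /(_ (x, 0)) h; apply: hx; exists 0; apply: h.
    by exists 1, (0, 0); rewrite scale1r scale1r addr0.
  right; split=> [y|a _ _ [b [p [Ap ->]]] [c [q [Aq ->]]]|c [a [q [Aq []]]]].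
  - by exists 0, (i y, lam y); rewrite scale0r scale0r add0r.
  - exists (a * b + c), (a%:A *: p.1 + q.1, a * p.2 + q.2); split; first exact: AL.
    congr pair; rewrite /= scalerDr addrACA scalerA -scalerAl mul1r scalerA.
    by rewrite -!scalerDl.
  - move=> h0 ->; have [a0|na0] := eqVneq a 0.
      move: h0; rewrite a0 scale0r scale0r add0r => h0.
      by apply: A0; rewrite h0; case: q Aq {h0}.
    case: hx; exists (- a^-1 * q.2 + 0).
    have := AL (- a^-1) _ _ Aq A00; rewrite /= addr0.
    suff -> : (- a^-1)%:A *: q.1 = x by [].
    have -> : q.1 = - (a%:A *: x).
      by apply/eqP; rewrite -addr_eq0 addrC -h0.
    by rewrite scalerN scalerA -scalerAl mul1r scalerA mulNr mulVf // scaleN1r scaleN1r opprK.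
have [Lam hLam] := choice Atot.
have Auniq x c c' : A (x, c) -> A (x, c') -> c = c'.
  move=> h /(AL (-1) _ _ h) /=; rewrite scaleN1r scaleN1r addNr mulN1r => /A0 /eqP.
  by rewrite addrC subr_eq0 => /eqP.
exists Lam; split=> [a x y|x]; last exact: Auniq (hLam _) (Abase x).
exact: Auniq (hLam _) (AL a _ _ (hLam x) (hLam y)).
Qed.

Lemma kdual_scale (c : K) (f : kdual R) x : (c%:A *: f) x = c * f x.
Proof. by rewrite /= -scalerAr mulr1 linearZ. Qed.

Fact kdual_eval_functional (M : lmodType R) (h : {linear M -> kdual R}) (r : R) :
  kfunctional (fun x => h x r).
Proof. by move=> a x y; rewrite linearP -kdual_scale. Qed.

Fact functional_act_scalar (N : lmodType R) (Lam : N -> K) (x : N) :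
  kfunctional Lam -> scalar (fun s : R => Lam (s *: x)).
Proof.
move=> hL a s t.
by rewrite scalerDl -hL scalerA -scalerAl mul1r.
Qed.

(** Evaluation at 1 identifies Hom_R(N, D(R)) with Hom_K(N, K), so that
extending a map to D(R) amounts to extending a functional. *)
Lemma kdual_injective : injective_module (kdual R : lmodType R).
Proof.
move=> M N i f i_inj.
have [Lam [hL hLam]] := kfunctional_ext i_inj (kdual_eval_functional f 1).
pose H (x : N) : kdual R := scalar_of (functional_act_scalar x hL).
have Hlin : linear H.
  move=> a x y; apply: kdualP => s /=.
  rewrite scalerDr scalerA.
  by have := hL 1 ((s * a) *: x) (s *: y); rewrite scale1r scale1r mul1r.
exists (linear_of Hlin) => x; apply: kdualP => s /=.
by rewrite -linearZ hLam linearZ /= mul1r.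
Qed.

(** The maps f embed D(R) in a free module, in which the injective module D(R)
is a direct summand; m collects the images of the standard basis under a
retraction. *)
Lemma kdual_dual_basis r (f : 'I_r -> {linear kdual R -> R^o}) :
  (forall x, (forall k, f k x = 0) -> x = 0) ->
  exists m : 'I_r -> kdual R, forall x, x = \sum_k (f k x : R) *: m k.
Proof.
move=> f_inj.
pose i (x : kdual R) : {ffun 'I_r -> R^o} := [ffun k => f k x].
have ilin : linear i by move=> a x y; apply/ffunP => k; rewrite !ffunE linearP.
have i_inj : injective (linear_of ilin).
  move=> x y /ffunP hxy; apply/eqP; rewrite -subr_eq0; apply/eqP/f_inj => k.
  by have := hxy k; rewrite /= !ffunE linearB => ->; rewrite subrr.
have [h hh] := kdual_injective (idfun : {linear kdual R -> kdual R}) i_inj.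
exists (fun k => h [ffun l => (l == k)%:R : R^o]) => x.
rewrite -[LHS]hh.
have -> : linear_of ilin x = \sum_k (f k x : R) *: [ffun l => (l == k)%:R : R^o].
  apply/ffunP => l; rewrite sum_ffunE (bigD1 l) //= !ffunE eqxx big1 => [|k nkl].
    by rewrite addr0 /GRing.scale /= mulr1.
  by rewrite !ffunE eq_sym (negbTE nkl) /GRing.scale /= mulr0.
by rewrite linear_sum; apply: eq_bigr => k _; rewrite linearZ.
Qed.

End FunctionalExtension.

(** * Projectivity of the dual of a finite dimensional algebra *)

Section QuasiFrobenius.
Variables (K : fieldType).

(** The left module D(R) is finitely generated projective, in the form of a dual
basis. *)
Definition kdual_projective (R : algType K) : Prop :=
  exists r (f : 'I_r -> {linear kdual R -> R^o}) (m : 'I_r -> kdual R),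
    forall x, x = \sum_k (f k x : R) *: m k.

(** The left module R is a direct summand of a power of D(R): the retraction is
given by f, the section sends 1 to m. *)
Definition kdual_generates (R : algType K) : Prop :=
  exists r (f : 'I_r -> {linear kdual R -> R^o}) (m : 'I_r -> kdual R),
    \sum_k f k (m k) = 1.

Section FiniteDim.
Variables (R : algType K) (hR : finspan R).

Lemma kdual_sumE I (r : seq I) (P : pred I) (F : I -> kdual R) x :
  (\sum_(i <- r | P i) F i) x = \sum_(i <- r | P i) F i x.
Proof. exact: (big_morph (fun f : kdual R => f x)). Qed.

Lemma kdual_separates (r s : R) : (forall x : kdual R, x r = x s) -> r = s.
Proof.
move=> h; have [n [e [c hc]]] := finspan_basis hR.
by rewrite (hc r) (hc s); apply: eq_bigr => t _; rewrite (h (c t)).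
Qed.

(** Finite dimensional spaces are reflexive: the representing element has
coordinates Phi (c t), for c the coordinate functionals of a basis. *)
Lemma kdual_reflexive (Phi : kdual R -> K) : kfunctional Phi ->
  exists r : R, forall x, Phi x = x r.
Proof.
move=> hPhi; have [n [e [c hc]]] := finspan_basis hR.
have Phi0 : Phi 0 = 0.
  have := hPhi 1 0 0; rewrite scaler0 addr0 mul1r => h.
  by apply: (addrI (Phi 0)); rewrite addr0 -h.
have PhiS (a : 'I_n -> K) (y : 'I_n -> kdual R) :
    Phi (\sum_t (a t)%:A *: y t) = \sum_t a t * Phi (y t).
  elim/big_rec2: _ => // t u v _ <-; exact: hPhi.
exists (\sum_t Phi (c t : kdual R) *: e t) => x.
have -> : x = \sum_t (x (e t))%:A *: (c t : kdual R).
  apply: kdualP => r; rewrite [in LHS](hc r) kdual_sumE linear_sum.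
  by apply: eq_bigr => t _; rewrite kdual_scale linearZ mulrC.
rewrite PhiS kdual_sumE; apply: eq_bigr => t _; rewrite kdual_scale.
congr (_ * _); rewrite linear_sum.
have -> : Phi (c t : kdual R) = \sum_s Phi (c s : kdual R) * c t (e s).
  have ct : (c t : kdual R) = \sum_s (c t (e s))%:A *: (c s : kdual R).
    apply: kdualP => r; rewrite [in LHS](hc r) kdual_sumE linear_sum.
    by apply: eq_bigr => s _; rewrite kdual_scale linearZ mulrC.
  by rewrite {1}ct PhiS; apply: eq_bigr => s _; rewrite mulrC.
by apply: eq_bigr => s _; rewrite linearZ.
Qed.

Fact ract_scalar (x : kdual R) (i : R) : scalar (fun s => x (i * s)).
Proof. by move=> a s t; rewrite mulrDr -scalerAr linearP. Qed.
(** D(R) is an R-bimodule; this is its right action. *)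
Definition ract (x : kdual R) (i : R) : kdual R := scalar_of (ract_scalar x i).

Lemma ractA x i j : ract (ract x i) j = ract x (i * j).
Proof. by apply: kdualP => s; rewrite /= mulrA. Qed.
Lemma ract_scale a x i : ract (a *: x) i = a *: ract x i.
Proof. by apply: kdualP => s; rewrite /= mulrA. Qed.
Lemma ract_suml I (r : seq I) (P : pred I) (F : I -> kdual R) i :
  ract (\sum_(t <- r | P t) F t) i = \sum_(t <- r | P t) ract (F t) i.
Proof. by apply: kdualP => s; rewrite kdual_sumE /= kdual_sumE. Qed.
Lemma ract_sumr I (r : seq I) (P : pred I) (F : I -> R) x :
  ract x (\sum_(t <- r | P t) F t) = \sum_(t <- r | P t) ract x (F t).
Proof. by apply: kdualP => s; rewrite kdual_sumE /= mulr_suml linear_sum. Qed.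

(** The endomorphisms of the left module D(R) are the right multiplications,
because D(D(R)) = R; this is the case of the endomorphism x |-> f(x) m. *)
Lemma kdual_end (f : {linear kdual R -> R^o}) (m : kdual R) :
  exists rho, forall x, (f x : R) *: m = ract x rho.
Proof.
have [|rho hrho] := @kdual_reflexive (fun x => m (f x)).
  move=> a x y; rewrite linearP linearD; congr (_ + _).
  by rewrite /GRing.scale /= -scalerAl mul1r linearZ.
exists rho => x; apply: kdualP => s /=.
by rewrite -[x (rho * s)]/((s *: x) rho) -hrho linearZ.
Qed.

(** The ideal of R generated by the values on D(R) I of all maps D(R) -> R. For
I = R it is the trace ideal of the module D(R). *)
Definition trace_ideal (I : R -> Prop) (x : R) : Prop :=
  exists (T : finType) (g : T -> {linear kdual R -> R^o}) (m : T -> kdual R) (i : T -> R),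
    (forall t, I (i t)) /\ x = \sum_t g t (ract (m t) (i t)).

Definition ideal (J : R -> Prop) : Prop :=
  [/\ J 0, forall x y, J x -> J y -> J (x + y), forall a x, J x -> J (a * x) &
      forall a x, J x -> J (x * a)].

Lemma ideal_sum J (T : finType) (F : T -> R) :
  ideal J -> (forall t, J (F t)) -> J (\sum_t F t).
Proof. by case=> J0 JD _ _ h; apply: (big_ind J) => // *; exact: JD. Qed.

Lemma trace_ideal_ideal I : ideal (trace_ideal I).
Proof.
split=> [|x y|a x|a x].
- exists void, (of_void _), (of_void _), (of_void _); split; first by case.
  by rewrite big_pred0 //; case.
- move=> [T [g [m [i [hi ->]]]]] [T' [g' [m' [i' [hi' ->]]]]].
  exists (T + T')%type.
  exists (fun u => match u with inl t => g t | inr t => g' t end).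
  exists (fun u => match u with inl t => m t | inr t => m' t end).
  exists (fun u => match u with inl t => i t | inr t => i' t end).
  by split; [case|rewrite big_sumType].
- move=> [T [g [m [i [hi ->]]]]].
  exists T, g, (fun t => a *: m t), i; split=> //.
  rewrite mulr_sumr; apply: eq_bigr => t _.
  by rewrite ract_scale linearZ.
- move=> [T [g [m [i [hi ->]]]]].
  have lin (h : {linear kdual R -> R^o}) : linear (fun x => (h x : R) * a : R^o).
    by move=> b y z; rewrite linearP mulrDl /GRing.scale /= mulrA.
  exists T, (fun t => linear_of (lin (g t))), m, i; split=> //.
  by rewrite mulr_suml; apply: eq_bigr => t _.
Qed.

Lemma trace_ideal_mono (I J : R -> Prop) : (forall x, I x -> J x) ->
  forall x, trace_ideal I x -> trace_ideal J x.
Proof.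
move=> h x [T [g [m [i [hi ->]]]]]; exists T, g, m, i; split=> // t; exact: h.
Qed.

(** When D(R) is projective, a two-sided ideal can be read off from its trace
ideal: expand x i twice along the dual basis, and write the coefficients, which
lie in trace_ideal J, as values of maps on D(R) J. Since maps x |-> f(x) m are
right multiplications, x i becomes x z for an element z of J independent of x. *)
Lemma trace_ideal_reflect r (f : 'I_r -> {linear kdual R -> R^o}) m (I J : R -> Prop) :
  (forall x : kdual R, x = \sum_k (f k x : R) *: m k) -> ideal J ->
  (forall x, trace_ideal I x -> trace_ideal J x) -> forall i, I i -> J i.
Proof.
move=> hfm hJ hIJ i Ii; have [J0 JD JMl JMr] := hJ.
have inJ k l b : trace_ideal J b ->
    exists z, J z /\ forall x, ((f k x : R) * b) *: m l = ract x z.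
  move=> [T [g [m' [j [hj ->]]]]].
  have /choice[z hz] : forall t, exists z, J z /\
      forall x, ((f k x : R) * (g t (ract (m' t) (j t)) : R)) *: m l = ract x z.
    move=> t; have [rho hrho] := kdual_end (f k) (m' t).
    have [rho' hrho'] := kdual_end (g t) (m l).
    exists (rho * j t * rho'); split=> [|x]; first exact/JMr/JMl.
    by rewrite -!ractA -hrho ract_scale -hrho' linearZ.
  exists (\sum_t z t); split=> [|x].
    by apply: ideal_sum => // t; have [] := hz t.
  rewrite mulr_sumr scaler_suml ract_sumr; apply: eq_bigr => t _.
  by have [_ ->] := hz t.
have inI k l : trace_ideal J (f l (ract (m k) i)).
  apply: hIJ; exists unit, (fun=> f l), (fun=> m k), (fun=> i); split=> //.
  by rewrite big_const card_unit /= addr0.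
have /choice[z hz] : forall p : 'I_r * 'I_r, exists z, J z /\
    forall x, ((f p.1 x : R) * (f p.2 (ract (m p.1) i) : R)) *: m p.2 = ract x z.
  by move=> [k l]; exact: inJ (inI k l).
(* i and the sum of the z p act alike on D(R), which separates points of R. *)
suff -> : i = \sum_p z p by apply: ideal_sum => // p; have [] := hz p.
apply: kdual_separates => x.
suff /(congr1 (fun y : kdual R => y 1)) : ract x i = ract x (\sum_p z p).
  by rewrite /= !mulr1.
rewrite {1}[x]hfm ract_suml ract_sumr.
transitivity (\sum_k \sum_l ract x (z (k, l))); last first.
  by rewrite pair_bigA; apply: eq_bigr => -[].
apply: eq_bigr => k _; rewrite ract_scale {1}[ract (m k) i]hfm scaler_sumr.
by apply: eq_bigr => l _; rewrite scalerA; have [_ <-] := hz (k, l).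
Qed.

(** Iterating trace_ideal from the unit ideal yields a descending chain of
ideals, which stabilises by finite dimension. By [trace_ideal_reflect] equality
at one step propagates down to the first one: the trace ideal of D(R) is R. *)
Theorem kdual_projective_generates : kdual_projective R -> kdual_generates R.
Proof.
move=> [r [f [m hfm]]].
pose I k := iter k trace_ideal (fun=> True).
have Iideal k : ideal (I k) by case: k => [|k]; [split|exact: trace_ideal_ideal].
have Idec k x : I k.+1 x -> I k x.
  elim: k x => // k IHk x; exact: trace_ideal_mono.
have [k hk] : exists k, forall x, I k x -> I k.+1 x.
  apply: (finspan_descending hR Idec) => k.
  - by have [] := Iideal k.
  - by have [_ + _ _] := Iideal k.
  - move=> a x hx; have [_ _ hM _] := Iideal k.
    by rewrite -[x]mul1r scalerAl; exact: hM.
have : I 1%N 1.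
  elim: k hk => [|k IHk] hk; first exact: hk.
  exact: IHk (trace_ideal_reflect hfm (Iideal k.+1) hk).
move=> [T [g [m' [i [_ h1]]]]].
exists #|T|, (fun k => g (enum_val k)), (fun k => ract (m' (enum_val k)) (i (enum_val k))).
by rewrite h1 (reindex (@enum_val T T)) //=; apply: onW_bij; exact: enum_val_bij.
Qed.

End FiniteDim.

Section AntiIsomorphism.
Variables (R R' : algType K) (tau : {linear R -> R'}) (tau' : R' -> R).
Hypotheses (hR : finspan R) (tauK : cancel tau tau') (tau'K : cancel tau' tau).
Hypotheses (tauM : forall a b, tau (a * b) = tau b * tau a) (tau1 : tau 1 = 1).

Fact tau'_linear : linear tau'.
Proof. by move=> a x y; apply: (can_inj tauK); rewrite linearP !tau'K. Qed.

Fact tau'M a b : tau' (a * b) = tau' b * tau' a.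
Proof. by apply: (can_inj tauK); rewrite tauM !tau'K. Qed.

Fact tau'_sum I (r : seq I) (P : pred I) (F : I -> R') :
  tau' (\sum_(t <- r | P t) F t) = \sum_(t <- r | P t) tau' (F t).
Proof. exact: (raddf_sum (linear_of tau'_linear)). Qed.

Fact tau'D a b : tau' (a + b) = tau' a + tau' b.
Proof. exact: (raddfD (linear_of tau'_linear)). Qed.

(** The dual of D(R) -> R, for R' the opposite algebra of R: it goes from D(R')
to D(D(R)) = R' and is linear over R'. *)
Lemma kdual_transpose (f : {linear kdual R -> R^o}) :
  exists g : {linear kdual R' -> R'^o},
    forall (phi : kdual R') (x : kdual R), x (tau' (g phi)) = phi (tau (f x)).
Proof.
have /choice[g hg] : forall phi : kdual R', exists r' : R',
    forall x : kdual R, x (tau' r') = phi (tau (f x)).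
  move=> phi; have [|r hr] := @kdual_reflexive R hR (fun x => phi (tau (f x))).
    move=> a x y; rewrite linearP !linearD; congr (_ + _).
    have -> : a%:A *: f x = a *: (f x : R) by rewrite -[LHS]/(_ * _) -scalerAl mul1r.
    by rewrite !linearZ.
  by exists (tau r) => x; rewrite tauK hr.
have glin : linear (g : kdual R' -> R'^o).
  move=> a phi psi; apply: (can_inj tau'K); apply: (kdual_separates hR) => x.
  rewrite tau'D linearD !hg /=; congr (_ + _).
  rewrite -[a *: _]/(a * _) tau'M -[RHS]/((tau' a *: x) (tau' (g phi))) hg.
  by rewrite linearZ /= -[_ *: f x]/(_ * _) tauM tau'K.
by exists (linear_of glin).
Qed.

Fact anti_scalar (m : kdual R) : scalar (fun r' => m (tau' r')).
Proof. by move=> a x y; rewrite tau'_linear linearP. Qed.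
Definition anti_dual (m : kdual R) : kdual R' := scalar_of (anti_scalar m).

(** Duality exchanges R and D(R) and the two sides, so that D(R) being a summand
of a power of R turns into R' being a summand of a power of D(R'). *)
Lemma kdual_projective_anti : kdual_projective R -> kdual_generates R'.
Proof.
move=> [r [f [m hfm]]]; have /choice[g hg] := fun k => kdual_transpose (f k).
exists r, g, (fun k => anti_dual (m k)).
apply: (can_inj tau'K); rewrite -tau1 tauK.
apply: (kdual_separates hR) => x.
rewrite tau'_sum linear_sum /= [in RHS](hfm x) kdual_sumE.
by apply: eq_bigr => k _; rewrite hg /= tauK mul1r.
Qed.

Lemma kdual_generates_anti : kdual_generates R -> kdual_projective R'.
Proof.
move=> [r [f [m hfm]]]; have /choice[g hg] := fun k => kdual_transpose (f k).
exists r, g, (fun k => anti_dual (m k)) => phi; apply: kdualP => s'.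
rewrite kdual_sumE -[s']tau'K; set s := tau' s'.
rewrite -[s in LHS]mulr1 -hfm mulr_sumr !linear_sum; apply: eq_bigr => k _.
rewrite /= tau'M tauK -[RHS]/((s *: m k) (tau' (g k phi))) hg linearZ.
by [].
Qed.

End AntiIsomorphism.

(** R is a direct summand of a power of the injective module D(R). *)
Lemma kdual_generates_selfinjective (R : algType K) :
  kdual_generates R -> injective_module (R^o : lmodType R).
Proof.
move=> [r [f [m hfm]]] M N i h i_inj.
have lin k : linear (fun x => (h x : R) *: m k).
  by move=> a x y; rewrite linearP scalerDl scalerA.
have /choice[H hH] := fun k => kdual_injective (linear_of (lin k)) i_inj.
have Hlin : linear (fun y => \sum_k f k (H k y)).
  move=> a x y; rewrite scaler_sumr -big_split; apply: eq_bigr => k _.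
  by rewrite !linearP.
exists (linear_of Hlin) => x /=.
under eq_bigr do rewrite hH /= linearZ.
rewrite -[RHS]mulr1 -hfm mulr_sumr.
by [].
Qed.

End QuasiFrobenius.

(** * Graded modules *)

Section GradedBasics.
Variables (K : fieldType) (B : galg K).
Implicit Types L M N : gmod B.

Lemma gmor0 M N (f : gmor M N) j : f j 0 = 0.
Proof. by apply: (addrI (f j 0)); rewrite -gfunD !addr0. Qed.

Lemma gmorN M N (f : gmor M N) j : {morph f j : x / - x}.
Proof. by move=> x; apply: (addrI (f j x)); rewrite -gfunD !subrr gmor0. Qed.

Lemma gmorB M N (f : gmor M N) j : {morph f j : x y / x - y}.
Proof. by move=> x y; rewrite gfunD gmorN. Qed.

Lemma gmor_sum M N (f : gmor M N) j I (r : seq I) (P : pred I) (F : I -> M j) :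
  f j (\sum_(i <- r | P i) F i) = \sum_(i <- r | P i) f j (F i).
Proof. exact: (big_morph (f j) (gfunD f (j := j)) (gmor0 f j)). Qed.

Lemma sum_gmorE M N I (r : seq I) (P : pred I) (F : I -> gmor M N) j x :
  (\sum_(i <- r | P i) F i) j x = \sum_(i <- r | P i) F i j x.
Proof. exact: (big_morph (fun f : gmor M N => f j x)). Qed.

Lemma gact0l M (i j k : int) (e : i + j = k) (x : M j) : gact e 0 x = 0.
Proof.
by apply: (addrI (gact e 0 x)); rewrite -(act_addl (gactP M)) !addr0.
Qed.

Lemma gact_suml M (i j k : int) (e : i + j = k) (x : M j) I (r : seq I)
    (P : pred I) (F : I -> Defs.comp B i) :
  gact e (\sum_(t <- r | P t) F t) x = \sum_(t <- r | P t) gact e (F t) x.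
Proof.
apply: (big_morph (fun b => gact e b x)); last exact: gact0l.
by move=> a b; rewrite (act_addl (gactP M)).
Qed.

Lemma gact_sumr M (i j k : int) (e : i + j = k) b I (r : seq I)
    (P : pred I) (F : I -> M j) :
  gact e b (\sum_(t <- r | P t) F t) = \sum_(t <- r | P t) gact e b (F t).
Proof.
apply: (big_morph (gact e b)); last exact: gact0.
by move=> x y; rewrite (act_addr (gactP M)).
Qed.

Definition gid M : gmor M M :=
  @Gmor K B M M (fun j x => x) (fun _ _ _ => erefl) (fun _ _ _ _ _ _ => erefl).

Record submod M := Submod {
  smem :> forall j, M j -> Prop;
  smem0 : forall j, smem (0 : M j);
  smemB : forall j (x y : M j), smem x -> smem y -> smem (x - y);
  smem_act : forall (i j k : int) (e : i + j = k) b (x : M j),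
    smem x -> smem (gact e b x) }.

Section Sub.
Variables (M : gmod B) (U : submod M).

Definition sub_pred j : {pred M j} := fun x => `[< U j x >].

Fact sub_zmod j : zmod_closed (@sub_pred j).
Proof.
split=> [|x y]; rewrite !unfold_in; first exact/asboolP/smem0.
by move=> /asboolP hx /asboolP hy; apply/asboolP/smemB.
Qed.
HB.instance Definition _ j := GRing.isZmodClosed.Build (M j) (@sub_pred j)
  (@sub_zmod j).

Definition sub_part j : Type := {x : M j | x \in @sub_pred j}.
HB.instance Definition _ j := SubChoice.on (sub_part j).
HB.instance Definition _ j := [SubChoice_isSubZmodule of sub_part j by <:].

Fact sub_act_subproof (i j k : int) (e : i + j = k) b (x : sub_part j) :
  gact e b (val x) \in @sub_pred k.
Proof.
by case: x => x hx /=; rewrite unfold_in; apply/asboolP/smem_act/asboolP.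
Qed.
Definition sub_act (i j k : int) (e : i + j = k) b (x : sub_part j) : sub_part k :=
  exist (fun y => y \in @sub_pred k) _ (sub_act_subproof e b x).

Fact sub_actP : @graded_action K B sub_part sub_act.
Proof.
case: (gactP M) => h1 h2 h3 h4.
by split=> [i j k e b x y|i j k e x a b|j e x|i j k ij jk l e1 e2 e3 e4 a b x];
  apply: val_inj; rewrite /= ?h1 ?h2 ?h3; last exact: h4.
Qed.
Definition gsub : gmod B := Gmod sub_actP.

Definition gsub_of j (x : M j) (h : U j x) : gsub j :=
  exist (fun y => y \in @sub_pred j) x (asboolT h).

Lemma gsubP j (x : gsub j) : U j (val x).
Proof. by case: x => x hx; apply/asboolP. Qed.

Definition gincl : gmor gsub M :=
  @Gmor K B gsub M (fun j x => val x) (fun j x y => erefl)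
    (fun i j k e b x => erefl).

Section Corestriction.
Variables (L : gmod B) (f : gmor L M) (hf : forall j x, U j (f j x)).
Definition gcor_fun j (x : L j) : gsub j := gsub_of (hf x).
Fact gcor_funD j : {morph @gcor_fun j : x y / x + y}.
Proof. by move=> x y; apply: val_inj; rewrite /= gfunD. Qed.
Fact gcor_fun_act (i j k : int) (e : i + j = k) b (x : L j) :
  gcor_fun (gact e b x) = gact e b (gcor_fun x).
Proof. by apply: val_inj; rewrite /= gfun_act. Qed.
Definition gcor : gmor L gsub := Gmor gcor_funD gcor_fun_act.
End Corestriction.

End Sub.

Fact image_mem0 M N (f : gmor M N) j : exists x, f j x = 0.
Proof. by exists 0; rewrite gmor0. Qed.
Fact image_memB M N (f : gmor M N) j (x y : N j) :
  (exists u, f j u = x) -> (exists u, f j u = y) -> exists u, f j u = x - y.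
Proof. by move=> [u <-] [v <-]; exists (u - v); rewrite gmorB. Qed.
Fact image_mem_act M N (f : gmor M N) (i j k : int) (e : i + j = k) b (x : N j) :
  (exists u, f j u = x) -> exists u, f k u = gact e b x.
Proof. by move=> [u <-]; exists (gact e b u); rewrite gfun_act. Qed.
Definition gimage M N (f : gmor M N) : submod N :=
  @Submod N (fun j y => exists x, f j x = y) (image_mem0 f) (@image_memB M N f)
    (@image_mem_act M N f).

(** Corestricting g to its image makes it surjective. *)
Lemma proj_lift (P M N : gmod B) (g : gmor M N) (f : gmor P N) :
  gprojective P -> (forall j x, exists y, g j y = f j x) ->
  exists h : gmor P M, forall j x, g j (h j x) = f j x.
Proof.
move=> hP hgf.
pose g' := gcor (U := gimage g) (f := g) (fun j x => ex_intro _ x erefl).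
pose f' := gcor (U := gimage g) (f := f) hgf.
have [|h hh] := hP _ _ g' f'.
  by move=> j y; have [x hx] := gsubP y; exists x; apply: val_inj.
by exists h => j x; have /(congr1 val) := hh j x.
Qed.

(** By the condition on kernels, f factors through the image of g, a submodule
of N. *)
Lemma inj_ext (E M N : gmod B) (g : gmor M N) (f : gmor M E) :
  ginjective E -> (forall j x, g j x = 0 -> f j x = 0) ->
  exists h : gmor N E, forall j x, h j (g j x) = f j x.
Proof.
move=> hE hgf.
have wd j (x y : M j) : g j x = g j y -> f j x = f j y.
  move=> exy; apply/eqP; rewrite -subr_eq0 -gmorB hgf //.
  by rewrite gmorB exy subrr.
pose pre j (y : gsub (gimage g) j) : M j := projT1 (cid (gsubP y)).
have preK j (y : gsub (gimage g) j) : g j (pre j y) = val y.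
  exact: (projT2 (cid (gsubP y))).
have fD j : {morph (fun y => f j (pre j y)) : x y / x + y}.
  by move=> x y; rewrite -gfunD; apply: wd; rewrite gfunD !preK.
have fA (i j k : int) (e : i + j = k) b (y : gsub (gimage g) j) :
    f k (pre k (gact e b y)) = gact e b (f j (pre j y)).
  by rewrite -gfun_act; apply: wd; rewrite gfun_act !preK.
have [|h hh] := hE _ _ (gincl (gimage g)) (Gmor fD fA).
  by move=> j; apply: val_inj.
exists h => j x.
pose y : gsub (gimage g) j :=
  gcor (U := gimage g) (f := g) (fun j x => ex_intro _ x erefl) j x.
by rewrite -[g j x]/(gincl (gimage g) j y) hh; apply: wd; rewrite preK.
Qed.

Section Power.
Variables (m : nat) (M : gmod B).
Definition pow_act (i j k : int) (e : i + j = k) b (x : {ffun 'I_m -> M j}) :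
  {ffun 'I_m -> M k} := [ffun t => gact e b (x t)].
Fact pow_actP :
  @graded_action K B (fun j => {ffun 'I_m -> M j} : zmodType) pow_act.
Proof.
case: (gactP M) => h1 h2 h3 h4.
by split=> [i j k e b x y|i j k e x a b|j e x|i j k ij jk l e1 e2 e3 e4 a b x];
  apply/ffunP => t; rewrite !ffunE ?h1 ?h2 ?h3 //; exact: h4.
Qed.
Definition gpow : gmod B := Gmod pow_actP.

Fact pow_projD t j : {morph (fun x : gpow j => x t) : x y / x + y}.
Proof. by move=> x y; rewrite ffunE. Qed.
Fact pow_proj_act t (i j k : int) (e : i + j = k) b (x : gpow j) :
  (gact e b x : gpow k) t = gact e b (x t).
Proof. by rewrite ffunE. Qed.
Definition pow_proj t : gmor gpow M :=
  Gmor (pow_projD t) (pow_proj_act t).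

Section Pair.
Variables (L : gmod B) (f : 'I_m -> gmor L M).
Fact pow_pairD j : {morph (fun x => [ffun t => f t j x] : gpow j) : x y / x + y}.
Proof. by move=> x y; apply/ffunP => t; rewrite !ffunE gfunD. Qed.
Fact pow_pair_act (i j k : int) (e : i + j = k) b (x : L j) :
  ([ffun t => f t k (gact e b x)] : gpow k) =
  gact e b ([ffun t => f t j x] : gpow j).
Proof. by apply/ffunP => t; rewrite !ffunE gfun_act. Qed.
Definition pow_pair : gmor L gpow := Gmor pow_pairD pow_pair_act.
End Pair.

Definition pow_inj t : gmor M gpow :=
  pow_pair (fun s => if s == t then gid M else 0).

Lemma pow_inj_sum j (x : gpow j) : x = \sum_t pow_inj t j (x t).
Proof.
apply/ffunP => s; rewrite sum_ffunE (bigD1 s) //= big1 ?addr0.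
  by rewrite ffunE eqxx.
by move=> t /negbTE nts; rewrite ffunE eq_sym nts.
Qed.

End Power.

End GradedBasics.

(** * Comparison of projective resolutions *)

Section Comparison.
Variables (K : fieldType) (B : galg K).
Implicit Types L M N : gmod B.

Lemma pexactP M (P : proj_res M) n j x :
  pdiff P n j x = 0 <-> exists y, pdiff P n.+1 j y = x.
Proof. exact: (@pexact _ _ _ P n j x). Qed.

Lemma pexact0P M (P : proj_res M) j x :
  paug P j x = 0 <-> exists y, pdiff P 0 j y = x.
Proof. exact: (@pexact0 _ _ _ P j x). Qed.

Lemma pdiff_pdiff M (P : proj_res M) n j x : pdiff P n j (pdiff P n.+1 j x) = 0.
Proof. by apply/pexactP; exists x. Qed.

Lemma paug_pdiff M (P : proj_res M) j x : paug P j (pdiff P 0 j x) = 0.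
Proof. by apply/pexact0P; exists x. Qed.

(** The recursion runs over commuting pairs of consecutive components, which is
the information that the choice of the next component needs. *)
Lemma chain_lift M M' (f : gmor M M') (P : proj_res M) (P' : proj_res M') :
  exists F : forall n, gmor (P n) (P' n),
    (forall j x, paug P' j (F 0 j x) = f j (paug P j x)) /\
    (forall n j x, pdiff P' n j (F n.+1 j x) = F n j (pdiff P n j x)).
Proof.
have [F0 hF0] : exists h : gmor (P 0) (P' 0),
    forall j x, paug P' j (h j x) = gcomp f (paug P) j x.
  apply: (@proj_lift _ _ (P 0) _ _ (paug P') (gcomp f (paug P))) => [|j x].
    exact: pterm_proj.
  exact: paug_surj.
have [F1 hF1] : exists h : gmor (P 1) (P' 1),
    forall j x, pdiff P' 0 j (h j x) = gcomp F0 (pdiff P 0) j x.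
  apply: (@proj_lift _ _ (P 1) _ _ (pdiff P' 0) (gcomp F0 (pdiff P 0))).
    exact: pterm_proj.
  move=> j x; apply/pexact0P.
  by rewrite /= hF0 /= paug_pdiff gmor0.
pose comm n (p : gmor (P n) (P' n) * gmor (P n.+1) (P' n.+1)) :=
  forall j x, pdiff P' n j (p.2 j x) = p.1 j (pdiff P n j x).
have step n (p : {p | @comm n p}) :
    {q : {q | @comm n.+1 q} | (sval q).1 = (sval p).2}.
  apply: cid; case: p => [[a b] /= hab].
  have [|c hc] := @proj_lift _ _ (P n.+2) _ _ (pdiff P' n.+1)
    (gcomp b (pdiff P n.+1)) (@pterm_proj _ _ _ P n.+2).
    by move=> j x; apply/pexactP; rewrite /= hab /= pdiff_pdiff gmor0.
  by exists (exist (@comm n.+1) (b, c) hc).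
pose fix s n : {p | @comm n p} :=
  if n is m.+1 then sval (step m (s m)) else exist (@comm 0) (F0, F1) hF1.
exists (fun n => (sval (s n)).1); split=> // n j x.
by rewrite [in LHS]/= (svalP (step n (s n))) (svalP (s n)).
Qed.

Lemma coboundary_comp M (P : proj_res M) n L L' (g : gmor L L') (f : gmor (P n) L) :
  is_coboundary f -> is_coboundary (gcomp g f).
Proof.
case: n f => [|n] f /=; first by move=> ->; apply: gmorP => j x; rewrite /= gmor0.
by move=> [h ->]; exists (gcomp g h); apply: gmorP.
Qed.

Lemma coboundaryN M (P : proj_res M) n L (f : gmor (P n) L) :
  is_coboundary f -> is_coboundary (- f).
Proof. by rewrite -(sub0r f); apply/is_coboundaryB/is_coboundary0. Qed.

Lemma coboundaryD M (P : proj_res M) n L (f g : gmor (P n) L) :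
  is_coboundary f -> is_coboundary g -> is_coboundary (f + g).
Proof.
by move=> hf /coboundaryN hg; rewrite -(opprK g); apply: is_coboundaryB.
Qed.

Lemma coboundary_cocycle M (P : proj_res M) n L (f : gmor (P n) L) j x :
  is_coboundary f -> f j (pdiff P n j x) = 0.
Proof.
case: n f x => [|n] f x /=; first by move=> ->.
by move=> [h ->]; rewrite /= pdiff_pdiff gmor0.
Qed.

(** A chain map that lifts zero is null-homotopic. Only the component h of the
homotopy in degree n appears; the one in degree n - 1 is the witness hidden in
is_coboundary, so that no coherent choice over all n is required. *)
Lemma homotopy M M' (P : proj_res M) (P' : proj_res M')
    (G : forall n, gmor (P n) (P' n)) :
  (forall j x, paug P' j (G 0 j x) = 0) ->
  (forall n j x, pdiff P' n j (G n.+1 j x) = G n j (pdiff P n j x)) ->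
  forall n, exists h : gmor (P n) (P' n.+1),
    is_coboundary (G n - gcomp (pdiff P' n) h).
Proof.
move=> hG0 hG; elim=> [|n [h hh]].
  have [|h hh] := @proj_lift _ _ (P 0) _ _ (pdiff P' 0) (G 0) (@pterm_proj _ _ _ P 0).
    by move=> j x; apply/pexact0P.
  by exists h; apply: gmorP => j x; rewrite /= hh subrr.
have [|h' hh'] := @proj_lift _ _ (P n.+1) _ _ (pdiff P' n.+1)
    (G n.+1 - gcomp h (pdiff P n)) (@pterm_proj _ _ _ P n.+1).
  move=> j x; apply/pexactP; rewrite gmorB hG.
  exact: (coboundary_cocycle x hh).
by exists h', h; apply: gmorP => j x; rewrite /= hh' subKr.
Qed.

Lemma null_homotopic_cocycle M M' (P : proj_res M) (P' : proj_res M')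
    (G : forall n, gmor (P n) (P' n)) L n (f : gmor (P' n) L) :
  (forall j x, paug P' j (G 0 j x) = 0) ->
  (forall n j x, pdiff P' n j (G n.+1 j x) = G n j (pdiff P n j x)) ->
  (forall j x, f j (pdiff P' n j x) = 0) -> is_coboundary (gcomp f (G n)).
Proof.
move=> hG0 hG hf; have [h hh] := homotopy hG0 hG n.
have -> : gcomp f (G n) = gcomp f (G n - gcomp (pdiff P' n) h).
  by apply: gmorP => j x; rewrite /= gmorB hf subr0.
exact: coboundary_comp.
Qed.

(** Two resolutions of M are homotopy equivalent, here in the form in which it
acts on cocycles. *)
Lemma comparison_cocycle M (P P' : proj_res M) :
  exists (u : forall n, gmor (P n) (P' n)) (v : forall n, gmor (P' n) (P n)),
  [/\ forall n j x, pdiff P' n j (u n.+1 j x) = u n j (pdiff P n j x),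
      forall n j x, pdiff P n j (v n.+1 j x) = v n j (pdiff P' n j x),
      forall n L (f : gmor (P n) L), (forall j x, f j (pdiff P n j x) = 0) ->
        is_coboundary (f - gcomp (gcomp f (v n)) (u n)) &
      forall n L (f : gmor (P' n) L), (forall j x, f j (pdiff P' n j x) = 0) ->
        is_coboundary (f - gcomp (gcomp f (u n)) (v n))].
Proof.
have [u [hu0 hu]] := chain_lift (gid M) P P'.
have [v [hv0 hv]] := chain_lift (gid M) P' P.
exists u, v; split=> // n L f hf.
  have -> : f - gcomp (gcomp f (v n)) (u n) =
            gcomp f (gid (P n) - gcomp (v n) (u n)).
    by apply: gmorP => j x; rewrite /= gmorB.
  apply: (@null_homotopic_cocycle _ _ P P
    (fun n => gid (P n) - gcomp (v n) (u n))) => //.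
    by move=> j x; rewrite /= gmorB hv0 /= hu0 subrr.
  by move=> m j x; rewrite /= gmorB hv hu.
have -> : f - gcomp (gcomp f (u n)) (v n) =
          gcomp f (gid (P' n) - gcomp (u n) (v n)).
  by apply: gmorP => j x; rewrite /= gmorB.
apply: (@null_homotopic_cocycle _ _ P' P'
  (fun n => gid (P' n) - gcomp (u n) (v n))) => //.
  by move=> j x; rewrite /= gmorB hu0 /= hv0 subrr.
by move=> m j x; rewrite /= gmorB hu hv.
Qed.

Lemma coboundary_chain M M' (P : proj_res M) (P' : proj_res M')
    (u : forall n, gmor (P n) (P' n)) L n (f : gmor (P' n) L) :
  (forall n j x, pdiff P' n j (u n.+1 j x) = u n j (pdiff P n j x)) ->
  is_coboundary f -> is_coboundary (gcomp f (u n)).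
Proof.
move=> hu; case: n f => [|n] f /=; first by move=> ->; apply: gmorP.
by move=> [h ->]; exists (gcomp h (u n)); apply: gmorP => j x; rewrite /= hu.
Qed.

End Comparison.

Section ExtIndependence.
Variables (K : fieldType) (B B' : galg K).
Variables (M : gmod B) (N : gbimod B B').

Lemma cocycleP (P : proj_res M) n j (f : cochain P N n j) :
  reflect (forall i x, f i (pdiff P n i x) = 0) (f \in @cocycle_pred _ _ _ _ P N n j).
Proof.
apply: (iffP idP) => [|h]; rewrite unfold_in.
  by move=> /eqP h i x; have := congr1 (fun g : gmor _ _ => g i x) h.
by apply/eqP/gmorP.
Qed.

Lemma ext_class_eq0 (P : proj_res M) n j (f : cocycle P N n j) :
  \pi_(ext_part P N n j) f = 0 <-> is_coboundary (val f).
Proof.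
have -> : (0 : ext_part P N n j) = \pi_(ext_part P N n j) 0.
  by apply: esym; exact: (raddf0 (\pi_(Quotient.quot (@coboundary _ _ _ _ P N n j)))).
split=> [/eqP|h]; last by apply: ext_eqP; rewrite subr0.
by rewrite -Quotient.idealrBE subr0 => /asboolP.
Qed.

(** A vanishing or an isomorphism of Ext speaks of one resolution; with
[comparison_cocycle] it applies to the cocycles of every resolution. *)
Lemma ext_zero_coboundary n : ext_zero n M N ->
  forall (P : proj_res M) j (f : gmor (P n) (shift (bmod1 N) j)),
    (forall i x, f i (pdiff P n i x) = 0) -> is_coboundary f.
Proof.
move=> [P' hP'] P j f hf.
have [u [v [hu hv huv _]]] := comparison_cocycle P P'.
have hfv : (gcomp f (v n) : cochain P' N n j) \in @cocycle_pred _ _ _ _ P' N n j.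
  by apply/cocycleP => i x; rewrite /= -hv hf.
have := hP' j (\pi_(ext_part P' N n j)
  (exist (fun g => g \in @cocycle_pred _ _ _ _ P' N n j) _ hfv)).
move=> /ext_class_eq0 /= /(coboundary_chain hu).
move=> /(coboundaryD (huv n _ f hf)).
by rewrite subrK.
Qed.

(** The map c is f |-> class of f, transported to E. *)
Lemma ext_isom_classes n (E : gmod B') : ext_isom n M N E ->
  forall P : proj_res M, exists c : forall j, cocycle P N n j -> E j,
  [/\ forall j, {morph @c j : f g / f - g},
      forall (i j k : int) (e : i + j = k) b f,
        c k (cocycle_act e b f) = gact e b (c j f),
      forall j f, c j f = 0 <-> is_coboundary (val f) &
      forall j x, exists f, c j f = x].
Proof.
move=> [P' [phi hphi]] P.
have [u [v [hu hv huv hvu]]] := comparison_cocycle P P'.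
have hfv j (f : cocycle P N n j) :
    (gcomp (val f) (v n) : cochain P' N n j) \in @cocycle_pred _ _ _ _ P' N n j.
  by apply/cocycleP => i x; have /cocycleP hf := valP f; rewrite /= -hv hf.
have hfu j (f : cocycle P' N n j) :
    (gcomp (val f) (u n) : cochain P N n j) \in @cocycle_pred _ _ _ _ P N n j.
  by apply/cocycleP => i x; have /cocycleP hf := valP f; rewrite /= -hu hf.
pose t j (f : cocycle P N n j) : cocycle P' N n j :=
  exist (fun g => g \in @cocycle_pred _ _ _ _ P' N n j) _ (hfv j f).
pose c j (f : cocycle P N n j) : E j := phi j (\pi_(ext_part P' N n j) (t j f)).
have cB j : {morph @c j : f g / f - g}.
  move=> f g; rewrite /c -gmorB; congr (phi j _).
  apply: etrans (raddfB (\pi_(Quotient.quot (@coboundary _ _ _ _ P' N n j))) _ _).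
  by congr (\pi_(_) _); apply: val_inj; apply: gmorP.
have phi_inj j : injective (phi j) by apply: bij_inj.
have c0 j f : c j f = 0 <-> is_coboundary (val f).
  rewrite /c -(gmor0 phi j); split=> [/phi_inj/ext_class_eq0 /=|h].
    move=> /(coboundary_chain hu).
    have /cocycleP hf := valP f.
    move=> /(coboundaryD (huv n _ _ hf)).
    by rewrite subrK.
  by congr (phi j _); apply/ext_class_eq0; apply: (coboundary_chain hv).
exists c; split=> //.
  move=> i j k e b f; rewrite /c -gfun_act; congr (phi k _).
  rewrite [RHS]ext_actE; congr (\pi_(_) _); apply: val_inj; exact: gmorP.
move=> j x; have [psi phiK psiK] := hphi j.
pose g : cocycle P' N n j := repr (psi x).
pose f : cocycle P N n j :=
  exist (fun g => g \in @cocycle_pred _ _ _ _ P N n j) _ (hfu j g).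
exists f; rewrite /c -[x]psiK; congr (phi j _).
rewrite [RHS](ext_reprK (psi x)) -/g.
apply: ext_eqP => /=.
have /cocycleP hg := valP g.
have := coboundaryN (hvu n _ _ hg).
by rewrite opprB.
Qed.

End ExtIndependence.

(** * Generators and finite dimensional components *)

Section Generation.
Variables (K : fieldType) (B : galg K).
Implicit Types L M N : gmod B.

Lemma comp_neg (i : int) (b : Defs.comp B i) : i < 0 -> b = 0.
Proof.
case: i b => // n b _; apply: val_inj.
by have := valP b; rewrite /= unfold_in /= => /eqP.
Qed.

Lemma gen_low M (n k : int) (x : M k) : generated_in M n -> k < n -> x = 0.
Proof.
move=> /(_ (k - n) k (subrK n k) x)[r [b [m ->]]] hk; apply: big1 => t _.
by rewrite [b t]comp_neg ?gact0l // subr_lt0.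
Qed.

Lemma gen_mor0 L M (n : int) (f : gmor L M) :
  generated_in L n -> (forall x, f n x = 0) -> forall j x, f j x = 0.
Proof.
move=> hL hf j x; have [r [b [m ->]]] := hL (j - n) j (subrK n j) x.
by rewrite gmor_sum big1 // => t _; rewrite gfun_act hf gact0.
Qed.

Lemma gen_mor_low L M (n m : int) (f : gmor L M) : generated_in L n ->
  generated_in M m -> n < m -> forall j x, f j x = 0.
Proof. by move=> hL hM lt; apply: gen_mor0 hL _ => x; exact: gen_low hM lt. Qed.

Lemma gen_zero M n : gzero M -> generated_in M n.
Proof.
move=> h i k e x; exists 0, (fun=> 0), (fun=> 0).
by rewrite big_ord0; apply: h.
Qed.

Lemma gen_intro M (n : int) :
  (forall (i k : int) (e : i + n = k) (x : M k),
     exists (I : finType) (b : I -> Defs.comp B i) (m : I -> M n),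
       x = \sum_t gact e (b t) (m t)) -> generated_in M n.
Proof.
move=> h i k e x; have [I [b [m ->]]] := h i k e x.
exists #|I|, (fun t => b (enum_val t)), (fun t => m (enum_val t)).
by rewrite (reindex (@enum_val I I)) //=; apply: onW_bij; exact: enum_val_bij.
Qed.

Lemma gen_image L M (n : int) (f : gmor L M) :
  gsurj f -> generated_in L n -> generated_in M n.
Proof.
move=> hf hL i k e x; have [y <-] := hf k x; have [r [b [m ->]]] := hL i k e y.
exists r, b, (fun t => f n (m t)); rewrite gmor_sum.
by apply: eq_bigr => t _; rewrite gfun_act.
Qed.

Lemma gen_pow m M n : generated_in M n -> generated_in (gpow m M) n.
Proof.
move=> hM; apply: gen_intro => i k e x.
have /choice[s hs] : forall t : 'I_m, 
    exists s : {r : nat & (('I_r -> Defs.comp B i) * ('I_r -> M n))%type},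
    x t = \sum_u gact e ((projT2 s).1 u) ((projT2 s).2 u).
  move=> t; have [r [b [y h]]] := hM i k e (x t).
  by exists (existT _ r (b, y)).
exists {t : 'I_m & 'I_(projT1 (s t))}.
exists (fun p => (projT2 (s (tag p))).1 (tagged p)).
exists (fun p => pow_inj M (tag p) n ((projT2 (s (tag p))).2 (tagged p))).
rewrite -(@sig_big_dep _ _ _ _ _ predT (fun _ => predT)
  (fun t u => gact e ((projT2 (s t)).1 u) (pow_inj M t n ((projT2 (s t)).2 u)))) /=.
rewrite {1}(pow_inj_sum x); apply: eq_bigr => t _.
by rewrite hs gmor_sum; apply: eq_bigr => u _; rewrite gfun_act.
Qed.

Fact kc_subproof (c : K) : c%:A \in @homog K B 0.
Proof. by rewrite rpredZ // homog1. Qed.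
Definition kc (c : K) : Defs.comp B 0 := exist _ c%:A (kc_subproof c).

(** The components of a graded module are vector spaces through the scalars of
B_0; this alias carries that structure. *)
Definition kpart M (j : int) : Type := M j.
HB.instance Definition _ M j := GRing.Zmodule.on (kpart M j).
Definition kscale M (j : int) (c : K) (x : kpart M j) : kpart M j :=
  gact (add0r j) (kc c) x.
Fact kscaleA M j a b (x : kpart M j) : kscale a (kscale b x) = kscale (a * b) x.
Proof.
rewrite /kscale -(act_mul (gactP M) (add0r 0) (add0r j)).
by congr (gact _ _ x); apply: val_inj; rewrite /= -scalerAl mul1r scalerA.
Qed.
Fact kscale1 M j : left_id 1 (@kscale M j).
Proof.
move=> x; rewrite -[RHS](act_one (gactP M) (add0r j)).
by congr (gact _ _ x); apply: val_inj; rewrite /= scale1r.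
Qed.
Fact kscaleDr M j : right_distributive (@kscale M j) +%R.
Proof. by move=> c x y; rewrite /kscale (act_addr (gactP M)). Qed.
Fact kscaleDl M j (x : kpart M j) : {morph (@kscale M j)^~ x : a b / a + b}.
Proof.
move=> a b; rewrite /kscale -(act_addl (gactP M)).
by congr (gact _ _ x); apply: val_inj; rewrite /= scalerDl.
Qed.
HB.instance Definition _ M j := GRing.Zmodule_isLmodule.Build K (kpart M j)
  (@kscaleA M j) (@kscale1 M j) (@kscaleDr M j) (@kscaleDl M j).

Fact kgmor_linear M N (f : gmor M N) j : linear (f j : kpart M j -> kpart N j).
Proof. by move=> a x y; rewrite gfunD; congr (_ + _); exact: gfun_act. Qed.

Definition fdpart M j := finspan (kpart M j).

Lemma fdpart_inj M N (f : gmor M N) j : injective (f j) -> fdpart N j -> fdpart M j.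
Proof. by move=> hf; exact: (@finspan_inj _ _ _ (linear_of (@kgmor_linear M N f j)) hf). Qed.

Lemma gact_scale M (i j k : int) (e : i + j = k) c (b : Defs.comp B i) (x : kpart M j)
    (cb : Defs.comp B i) :
  val cb = c *: val b -> gact e cb x = c *: (gact e b x : kpart M k).
Proof.
move=> h; apply: etrans (act_mul (gactP M) (add0r i) e e (add0r k) (kc c) b x).
by congr (gact _ _ x); apply: val_inj; rewrite h /= -scalerAl mul1r.
Qed.

Lemma gact_scaler M (i j k : int) (e : i + j = k) c (b : Defs.comp B i) (x : kpart M j) :
  gact e b (c *: x : kpart M j) = c *: (gact e b x : kpart M k).
Proof.
apply: etrans (act_mul (gactP M) (add0r i) e e (add0r k) (kc c) b x).
apply: etrans (esym (act_mul (gactP M) (addr0 i) e (add0r j) e b (kc c) x)) _.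
by congr (gact _ _ x); apply: val_inj; rewrite /= -scalerAl mul1r -scalerAr mulr1.
Qed.

Lemma comp_span (i : int) : exists (r : nat) (e : 'I_r -> Defs.comp B i),
  forall b : Defs.comp B i, exists c : 'I_r -> K, val b = \sum_t c t *: val (e t).
Proof.
case: i => n; last first.
  exists 0, (fun=> 0) => b; exists (fun=> 0).
  by rewrite big_ord0 [b]comp_neg.
have [r [e he]] := pr_findim B n.
have hp t : pr B n (e t) \in @homog K B n by rewrite unfold_in /= pr_pr eqxx.
exists r, (fun t => exist _ (pr B n (e t)) (hp t)) => b.
have [c hc] := he (val b); exists c.
have hb : pr B n (val b) = val b by apply/eqP; exact: valP b.
transitivity (pr B n (pr B n (val b))); first by rewrite !hb.
rewrite hc linear_sum.
by apply: eq_bigr => t _; rewrite linearZ.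
Qed.

Lemma fdpart_gen M (n k : int) : generated_in M n -> fdpart M n -> fdpart M k.
Proof.
move=> hM [r [y hy]]; have [s [e he]] := comp_span (k - n).
apply: (@finspan_fin _ _ ('I_s * 'I_r)%type
  (fun p => gact (subrK n k) (e p.1) (y p.2) : kpart M k)) => x.
have [l [b [m ->]]] := hM _ _ (subrK n k) x.
apply: in_span_sum => t; have [c hc] := he (b t); have [a ha] := hy (m t).
pose ce u : Defs.comp B (k - n) :=
  exist _ (c u *: val (e u)) (rpredZ (c u) (valP (e u))).
have -> : b t = \sum_u ce u.
  apply: val_inj; rewrite hc /=.
  by rewrite (big_morph val (fun _ _ => erefl) (erefl : val (0 : Defs.comp B _) = 0)).
rewrite gact_suml; apply: in_span_sum => u.
rewrite ha gact_sumr; apply: in_span_sum => v.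
rewrite (gact_scale _ (c := c u) (b := e u)) // gact_scaler.
do 2! apply: in_spanZ.
exact: (in_span_mem (fun p => gact (subrK n k) (e p.1) (y p.2) : kpart M k) (u, v)).
Qed.

Lemma deg0_finspan : finspan (deg0 B).
Proof.
have [r [e he]] := comp_span 0.
exists r, e => x; have [c hc] := he x; exists c.
apply: val_inj; rewrite hc.
by rewrite (big_morph val (fun _ _ => erefl) (erefl : val (0 : deg0 B) = 0)).
Qed.

Lemma gS_fdpart j : fdpart (gS B) j.
Proof.
have lin : linear (fun x : kpart (gS B) j => val x : deg0 B).
  move=> c x y /=; congr (_ + _); apply: val_inj => /=.
  by rewrite linearZ /= pr_one -scalerAl mul1r.
apply: (@finspan_inj _ _ _ (linear_of lin)) => [|]; first exact: val_inj.
exact: deg0_finspan.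
Qed.

(** By linearity P_(n+2) vanishes in degree n + 1, so that the generators of
P_(n+1) embed in a component of P_n, which is finite dimensional by induction. *)
Lemma koszul_res_fdpart (P : proj_res (gS B)) :
  (forall n : nat, generated_in (P n) n) -> forall n : nat, fdpart (P n) n.
Proof.
have ker0 M N (f : gmor M N) j : (forall x, f j x = 0 -> x = 0) -> injective (f j).
  by move=> h x y exy; apply/eqP; rewrite -subr_eq0; apply/eqP/h; rewrite gmorB exy subrr.
move=> hP; elim=> [|n IHn].
  apply: (@fdpart_inj _ _ (paug P)); last exact: gS_fdpart.
  apply: ker0 => x /pexact0P[y <-].
  by rewrite (gen_low y (hP 1%N)) // gmor0.
apply: (@fdpart_inj _ _ (pdiff P n)); last exact: fdpart_gen (hP n) IHn.
apply: ker0 => x /pexactP[y <-].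
by rewrite (gen_low y (hP n.+2)) ?ltz_nat // gmor0.
Qed.

End Generation.

(** * Duality with the regular bimodule *)

Section Duality.
Variables (K : fieldType) (B : galg K).
Local Notation RB := (bswap (reg B)).

(** Components in equal degrees need not be the same type, but all of them are
subtypes of B; equations between their elements are checked in B. *)
Definition cval (i : int) (b : Defs.comp B i) : B := val b.

Lemma cval_inj (i : int) : injective (@cval i).
Proof. exact: val_inj. Qed.

Lemma cval_sum (i : int) I (r : seq I) (P : pred I) (F : I -> Defs.comp B i) :
  cval (\sum_(t <- r | P t) F t) = \sum_(t <- r | P t) cval (F t).
Proof. exact: (big_morph (@cval i)). Qed.

Definition ccast (i j : int) (e : i = j) (b : Defs.comp B i) : Defs.comp B j :=
  exist (fun b => b \in homog j) (val b)
    (etrans (congr1 (fun k => val b \in homog k) (esym e)) (valP b)).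

Section Free.
Variables (L : gmod (op B)) (n : int) (y : L n).

Definition orbit_fun j (b : shift (bmod1 RB) (- n) j) : L j :=
  gact (subrK n j) (b : Defs.comp (op B) (j - n)) y.
Fact orbit_funD j : {morph @orbit_fun j : a b / a + b}.
Proof.
move=> a b; rewrite /orbit_fun -(act_addl (gactP L)).
congr (gact _ _ y); exact: (@val_inj _ _ (Defs.comp (op B) (j - n))).
Qed.
Fact orbit_fun_act (i j k : int) (e : i + j = k) (b : Defs.comp (op B) i)
    (x : shift (bmod1 RB) (- n) j) :
  orbit_fun (gact e b x) = gact e b (orbit_fun x).
Proof.
rewrite /orbit_fun.
apply: etrans (act_mul (gactP L) (shift_eq (- n) e) (subrK n k) (subrK n j) e b _ y).
congr (gact _ _ y); exact: (@val_inj _ _ (Defs.comp (op B) (k - n))).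
Qed.
Definition orbit_map : gmor (shift (bmod1 RB) (- n)) L :=
  Gmor orbit_funD orbit_fun_act.
End Free.

(** Finitely generated projective modules with generators in the single degree n
are handled through a dual basis: generators y with coordinate maps f to B(-n). *)
Definition dual_basis (L : gmod (op B)) (n : int) r (y : 'I_r -> L n)
    (f : 'I_r -> gmor L (shift (bmod1 RB) (- n))) : Prop :=
  forall j x, x = \sum_k orbit_map (y k) j (f k j x).

(** Generators define a surjection from a free module B(-n)^r, and the components
of a section of it are the coordinate maps. *)
Lemma dual_basis_exists (L : gmod (op B)) (n : int) :
  gprojective L -> generated_in L n -> fdpart L n ->
  exists r (y : 'I_r -> L n) f, dual_basis y f.
Proof.
move=> hproj hgen [r [y hy]].
pose F := gpow r (shift (bmod1 RB) (- n)).
pose p : gmor F L := \sum_k gcomp (orbit_map (y k)) (pow_proj _ k).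
have pE j (b : F j) : p j b = \sum_k orbit_map (y k) j (b k) by rewrite sum_gmorE.
have p_inj k j b : p j (pow_inj _ k j b) = orbit_map (y k) j b.
  rewrite pE (bigD1 k) //= big1 => [|t ntk]; rewrite ?addr0 !ffunE ?eqxx //.
  by rewrite (negbTE ntk); exact: (gmor0 (orbit_map (y t))).
have psurj : gsurj p.
  move=> j x; have [l [b [m ->]]] := hgen _ _ (subrK n j) x.
  suff /choice[z hz] : forall t, exists z, p j z = gact (subrK n j) (b t) (m t).
    by exists (\sum_t z t); rewrite gmor_sum; apply: eq_bigr.
  move=> t; have [c ->] := hy (m t).
  pose cb k : Defs.comp (op B) (j - n) :=
    exist _ (c k *: val (b t)) (rpredZ (c k) (valP (b t))).
  exists (\sum_k pow_inj (shift (bmod1 RB) (- n)) k j (cb k)).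
  rewrite gmor_sum gact_sumr; apply: eq_bigr => k _.
  rewrite p_inj; apply: etrans (esym (gact_scaler _ (c k) (b t) (y k))).
  exact: gact_scale.
have [h hh] := hproj _ _ p (gid L) psurj.
exists r, y, (fun k => gcomp (pow_proj _ k) h) => j x.
by rewrite -[LHS]hh pE.
Qed.

Section Dual.
Variable L : gmod (op B).

Fact gdual_actP : @graded_action K B
  (fun u => gmor L (shift (bmod1 RB) u) : zmodType) (@post _ _ _ RB L).
Proof.
split=> [i j k e b f g|i j k e f a b|j e f|i j k ij jk l e1 e2 e3 e4 a b f].
- exact: postD.
- exact: postDl.
- exact: post1.
- exact: postM.
Qed.
Definition gdual : gmod B := Gmod gdual_actP.
End Dual.

Definition dval L u (q : gdual L u) j (x : L j) : B := @cval (j + u) (q j x).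

Implicit Types L : gmod (op B).

Lemma dval_inj L u (q q' : gdual L u) :
  (forall j x, dval q (j := j) x = dval q' x) -> q = q'.
Proof. by move=> h; apply: gmorP => j x; apply: cval_inj; exact: h. Qed.

Lemma dval_act L (i j k : int) (e : i + j = k) b (q : gdual L j) l (x : L l) :
  dval (gact e b q) x = cval b * dval q x.
Proof. by []. Qed.

Lemma dval_sum L u I (r : seq I) (P : pred I) (F : I -> gdual L u) j (x : L j) :
  dval (\sum_(t <- r | P t) F t) x = \sum_(t <- r | P t) dval (F t) x.
Proof. by rewrite /dval sum_gmorE cval_sum. Qed.

Lemma dval_orbit L n (y : L n) u (q : gdual L u) j (b : shift (bmod1 RB) (- n) j) :
  dval q (orbit_map y j b) = dval q y * cval (b : Defs.comp B (j - n)).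
Proof. by rewrite /dval /= /orbit_fun gfun_act. Qed.

Lemma dual_basis_dval L n r (y : 'I_r -> L n) f : dual_basis y f ->
  forall u (q : gdual L u) j x,
    dval q x = \sum_k dval q (y k) * dval (f k : gdual L (- n)) (j := j) x.
Proof.
move=> hyf u q j x; rewrite {1}[x]hyf /dval gmor_sum cval_sum.
by apply: eq_bigr => k _; exact: dval_orbit.
Qed.

Fact dual_deg (n u : int) : (n + u) - n = u.
Proof. by rewrite addrAC subrr add0r. Qed.

Lemma dual_basis_expand L n r (y : 'I_r -> L n) f : dual_basis y f ->
  forall u (q : gdual L u),
    q = \sum_k gact (dual_deg n u) (q n (y k) : Defs.comp B (n + u)) (f k : gdual L (- n)).
Proof.
move=> hyf u q; apply: dval_inj => j x.
by rewrite (dual_basis_dval hyf) dval_sum; apply: eq_bigr => k _; rewrite dval_act.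
Qed.

Lemma gdual_gen L n r (y : 'I_r -> L n) f :
  dual_basis y f -> generated_in (gdual L) (- n).
Proof.
move=> hyf i u e q.
have ei : n + u = i by rewrite -e addrC addrNK.
exists r, (fun k => ccast ei (q n (y k))), f.
rewrite {1}[q](dual_basis_expand hyf); apply: eq_bigr => k _.
by apply: dval_inj => j x; rewrite !dval_act.
Qed.

(** Hom(L, B) has the dual basis made of the f k and of the evaluations at the
y k, so that a map out of it is lifted by lifting the values at the f k. *)
Lemma gdual_proj L n r (y : 'I_r -> L n) f :
  dual_basis y f -> gprojective (gdual L).
Proof.
move=> hyf M N p g hp.
have /choice[m hm] : forall k, exists m, p (- n) m = g (- n) (f k) by move=> k; exact: hp.
pose h u (q : gdual L u) : M u :=
  \sum_k gact (dual_deg n u) (q n (y k) : Defs.comp B (n + u)) (m k).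
have hD u : {morph @h u : q q' / q + q'}.
  move=> q q'; rewrite /h -big_split; apply: eq_bigr => k _ /=.
  by rewrite -(act_addl (gactP M)).
have hA (i j k : int) (e : i + j = k) b (q : gdual L j) : h k (gact e b q) = gact e b (h j q).
  rewrite /h gact_sumr; apply: eq_bigr => t _.
  apply: etrans (act_mul (gactP M) (post_eq n e) (dual_deg n k) (dual_deg n j) e b _ (m t)).
  by [].
exists (Gmor hD hA) => u q /=; rewrite [in RHS](dual_basis_expand hyf q) /h !gmor_sum.
by apply: eq_bigr => k _; rewrite !gfun_act hm.
Qed.

Section DualMap.
Variables (L L' : gmod (op B)) (v : gmor L' L).
Fact gdual_mapD u : {morph (fun q : gdual L u => gcomp q v : gdual L' u) : q q' / q + q'}.
Proof. by move=> q q'; apply: gmorP. Qed.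
Fact gdual_map_act (i j k : int) (e : i + j = k) b (q : gdual L j) :
  gcomp (gact e b q : gdual L k) v = gact e b (gcomp q v : gdual L' j) :> gdual L' k.
Proof. exact: post_comp. Qed.
Definition gdual_map : gmor (gdual L) (gdual L') := Gmor gdual_mapD gdual_map_act.
End DualMap.

End Duality.

(** * Maps into a module of finite injective dimension *)

(** In this section Q is a cochain complex of projectives and eta an idempotent
endomorphism of it that is zero on cohomology, so that its image is an exact
complex, bounded on the left. If N has an injective resolution of length d, each
truncation of this exact complex is part of a projective resolution, and the
vanishing of Ext^i(-, N) for i > d makes Hom(-, N) exact at its first term.
The chase below avoids the cosyzygies of both complexes. *)
Section InjectiveChase.
Variables (K : fieldType) (B : galg K) (N : gmod B) (d : nat).
Variables (Q : nat -> gmod B) (dl : forall n, gmor (Q n) (Q n.+1)).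
Variable eta : forall n, gmor (Q n) (Q n).
Hypothesis Qproj : forall n, gprojective (Q n).
Hypothesis dl_dl : forall n j q, dl n.+1 j (dl n j q) = 0.
Hypothesis eta_dl : forall n j q, dl n j (eta n j q) = eta n.+1 j (dl n j q).
Hypothesis eta_idem : forall n j q, eta n j (eta n j q) = eta n j q.
Hypothesis eta_exact0 : forall j q, dl 0 j q = 0 -> eta 0 j q = 0.
Hypothesis eta_exact : forall n j q, dl n.+1 j q = 0 ->
  exists q', eta n.+1 j q = dl n j q'.

Lemma iexactP (I : inj_res N) n j x :
  idiff I n.+1 j x = 0 <-> exists y, idiff I n j y = x.
Proof. exact: (@iexact _ _ _ I n j x). Qed.

Lemma iexact0P (I : inj_res N) j x :
  idiff I 0 j x = 0 <-> exists y, iaug I j y = x.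
Proof. exact: (@iexact0 _ _ _ I j x). Qed.

(** Move one step to the right in Q and in I at the same time, until I vanishes:
k1 extends h to Q_(m+1) but need not be a cocycle in I; its coboundary is a map
of the same kind as h, with m and k increased, which factors by induction, and
lifting that factorisation through I_k corrects k1. *)
Lemma injective_chase (I : inj_res N) : (forall n, (d < n)%N -> gzero (I n)) ->
  forall e k m (h : gmor (Q m) (I k)), (d < k + e)%N ->
    (forall j q, idiff I k j (h j q) = 0) ->
    (forall j q, h j (eta m j q) = h j q) ->
    (forall j q, dl m j q = 0 -> h j q = 0) ->
    exists kappa : gmor (Q m.+1) (I k),
      (forall j q, idiff I k j (kappa j q) = 0) /\
      (forall j q, kappa j (dl m j q) = h j q).
Proof.
move=> I0; elim=> [|e IHe] k m h.
  rewrite addn0 => /I0 z _ _ _.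
  by exists 0; split=> j q /=; [rewrite gmor0|apply/esym/z].
rewrite addnS -addSn => lt dh heta hker.
have [k0 hk0] := inj_ext (@iterm_inj _ _ _ I k) hker.
(* Composing with eta makes the coboundary of k1 vanish on cocycles of Q. *)
pose k1 := gcomp k0 (eta m.+1).
have hk1 j q : k1 j (dl m j q) = h j q by rewrite /= -eta_dl hk0 heta.
have [||| kap [dkap hkap]] := IHe k.+1 m.+1 (gcomp (idiff I k) k1) lt.
- by move=> j q; apply/iexactP; exists (k1 j q).
- by move=> j q /=; rewrite eta_idem.
- move=> j q /eta_exact[q' hq'].
  change (idiff I k j (k0 j (eta m.+1 j q)) = 0).
  rewrite hq'.
  by rewrite hk0 dh.
have [|lam hlam] := @proj_lift _ _ _ _ _ (idiff I k) kap (@Qproj m.+2).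
  by move=> j q; apply/iexactP.
exists (k1 - gcomp lam (dl m.+1)); split=> j q.
  by rewrite gmorB hlam hkap subrr.
rewrite [LHS]/(k1 j (dl m j q) - lam j (dl m.+1 j (dl m j q))) hk1.
by rewrite dl_dl (gmor0 lam); exact: subr0.
Qed.

Lemma injdim_factor (h : gmor (Q 0) N) : injdim_le N d ->
  (forall j q, h j (eta 0 j q) = h j q) ->
  exists kappa : gmor (Q 1) N, forall j q, kappa j (dl 0 j q) = h j q.
Proof.
move=> [I I0] heta.
have [||||kap [dkap hkap]] := @injective_chase I I0 d.+1 0 0 (gcomp (iaug I) h).
- by [].
- by move=> j q; apply/iexact0P; exists (h j q).
- by move=> j q; rewrite /= heta.
- by move=> j q /eta_exact0 hq; rewrite /= -heta hq !gmor0.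
have [|lam hlam] := @proj_lift _ _ _ _ _ (iaug I) kap (@Qproj 1).
  by move=> j q; apply/iexact0P.
exists lam => j q; apply: (@iaug_inj _ _ _ I).
by rewrite hlam hkap.
Qed.

End InjectiveChase.

(** * Finiteness of the linear resolution of S *)

(** In this section P is a linear projective resolution of S_B, and its dual
Hom_B(P_n, B) has cohomology D(S), in cohomological degree d and internal
degree -d only. *)
Section Core.
Variables (K : fieldType) (B : galg K) (d : nat).
Local Notation RB := (bswap (reg B)).
Local Notation S := (deg0 B).
Variable P : proj_res (gS (op B)).
Hypothesis hP : forall n : nat, generated_in (P n) n.
Arguments hP : clear implicits.
Hypothesis ext0 : forall n : nat, n != d -> ext_zero n (gS (op B)) RB.
Hypothesis extd : ext_isom d (gS (op B)) RB (shift (gDS B) d).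
Hypothesis hinj : injdim_le (bmod1 (reg B)) d.

Lemma conc_zero (C : galg K) (M : lmodType (deg0 C)) j (x : conc M j) : j != 0 -> x = 0.
Proof.
move=> /negbTE hj; apply: val_inj; have := valP x.
by rewrite unfold_in hj => /eqP.
Qed.

Lemma res_dual_basis n : exists r (y : 'I_r -> P n n) f, dual_basis y f.
Proof.
apply: dual_basis_exists; first exact: pterm_proj; first exact: hP.
exact: (@koszul_res_fdpart K (op B) P hP n).
Qed.

Definition cocyc n (j : int) (q : gdual (P n) j) : Prop :=
  forall i x, q i (pdiff P n i x) = 0.

Lemma cocycle_coboundary (n : nat) (j : int) (q : gdual (P n) j) :
  (n != d) || (j != - d%:Z) -> cocyc q -> is_coboundary q.
Proof.
case: (eqVneq n d) q => [->|nd] q /= hj hq; last first.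
  exact: (ext_zero_coboundary (ext0 nd) hq).
have [c [_ _ c0 _]] := ext_isom_classes extd P.
have hq' : (q : cochain P RB d j) \in @cocycle_pred _ _ _ _ P RB d j.
  exact/cocycleP.
apply/(c0 j (exist (fun q => q \in @cocycle_pred _ _ _ _ P RB d j) _ hq')).
by apply: conc_zero; rewrite addr_eq0.
Qed.

(** A map to P_m is determined by its coordinates along a dual basis, which are
cochains with values in B(-m). *)
Lemma endo_coboundary (n m : nat) (g : gmor (P n) (P m)) :
  (n != d) || (m != d) -> (forall j x, g j (pdiff P n j x) = 0) -> is_coboundary g.
Proof.
move=> hnm hg; have [r [y [f hyf]]] := res_dual_basis m.
have hfg k : is_coboundary (gcomp (f k) g).
  apply: cocycle_coboundary => [|i x]; last by rewrite /= hg gmor0.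
  by rewrite eqr_opp.
case: n g hnm hg hfg => [|n] g hnm hg hfg /=.
  apply: gmorP => j x; rewrite [LHS]hyf big1 // => k _.
  have h0 : f k j (g j x) = 0 by have := congr1 (fun q : gmor _ _ => q j x) (hfg k).
  by rewrite h0; exact: gmor0.
have /choice[h hh] := hfg.
exists (\sum_k gcomp (orbit_map (y k)) (h k)); apply: gmorP => j x.
rewrite [LHS]hyf /= sum_gmorE; apply: eq_bigr => k _ /=; congr (orbit_fun _ _).
by have := congr1 (fun q : gmor _ _ => q j x) (hh k).
Qed.

(** Such a g factors through P_(n-1), whose generators have degree n - 1, where
P_n is zero. *)
Lemma endo_cocycle_eq0 (n : nat) (g : gmor (P n) (P n)) : n != d ->
  (forall j x, g j (pdiff P n j x) = 0) -> g = 0.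
Proof.
move=> nd /endo_coboundary; rewrite nd => /(_ isT).
case: n g {nd} => [|n] g //= [h ->]; apply: gmorP => j x /=.
have hlt : (n%:Z < n.+1%:Z)%R by rewrite ltz_nat.
exact: (@gen_mor_low _ _ _ _ _ _ h (hP n) (hP n.+1) hlt).
Qed.

(** Coboundaries come from maps P_(d-1) -> B(-d), which send the generators to
B_(-1) = 0. *)
Lemma low_cocycle (q : gdual (P d) (- d%:Z)) : is_coboundary q -> q = 0.
Proof.
case: d q => [|d'] q //= [h ->]; apply: gmorP => j x /=.
suff h0 (z : P d' d') : h d' z = 0 by exact: (@gen_mor0 _ _ _ _ _ h (hP d') h0).
by apply: (@comp_neg K B); rewrite subr_lt0 ltz_nat.
Qed.

(** By [low_cocycle], Ext^d(S_B, B) in internal degree -d consists of cocycles, not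
of classes, so that D(S) is a space of maps P_d -> B(-d). *)
Lemma top_cocycles_kdual : exists Z : kdual S -> gdual (P d) (- d%:Z),
  [/\ forall a x y, Z (a *: x + y) =
        gact (add0r _) (a : Defs.comp B 0) (Z x) + Z y,
      forall x, Z x = 0 -> x = 0, forall x, cocyc (Z x) &
      forall q, cocyc q -> exists x, Z x = q].
Proof.
have [c [cB cA c0 csurj]] := ext_isom_classes extd P.
pose cc q := (q : cochain P RB d (- d%:Z)) \in @cocycle_pred _ _ _ _ P RB d (- d%:Z).
have ccP q : cocyc q -> cc q by move=> hq; apply/cocycleP.
have hd (x : kdual S) : x \in conc_pred (- d%:Z + d%:Z) by rewrite unfold_in addNr eqxx.
pose ex x : shift (gDS B) d (- d%:Z) := exist (fun y => y \in conc_pred _) x (hd x).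
have cinj f g : c (- d%:Z) f = c (- d%:Z) g -> val f = val g.
  move=> hfg; apply/eqP; rewrite -subr_eq0; apply/eqP.
  have : c (- d%:Z) (f - g) = 0 by rewrite cB hfg subrr.
  by move=> /c0 /low_cocycle.
have /choice[Z hZ] : forall x, exists f, c (- d%:Z) f = ex x by move=> x; exact: csurj.
have cD f g : c (- d%:Z) (f + g) = c (- d%:Z) f + c (- d%:Z) g.
  have cN : c (- d%:Z) (- g) = - c (- d%:Z) g.
    have c00 : c (- d%:Z) 0 = 0 by rewrite -(subrr g) cB subrr.
    by rewrite -(sub0r g) cB c00 sub0r.
  by rewrite -{1}(opprK g) cB cN opprK.
exists (fun x => val (Z x)); split.
- move=> a x y.
  apply: (cinj (Z (a *: x + y)) (cocycle_act (add0r _) (a : Defs.comp B 0) (Z x) + Z y)).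
  rewrite cD cA !hZ; apply: val_inj => /=; congr (_ *: _ + _).
  by apply: val_inj; have := valP a; rewrite /= unfold_in => /eqP.
- move=> x hx; have /esym := hZ x.
  have -> : Z x = 0 by apply: val_inj.
  by rewrite -(subrr 0) cB subrr => /(congr1 val).
- by move=> x; apply/cocycleP/valP.
- move=> q /ccP hq.
  pose f : cocycle P RB d (- d%:Z) := exist (fun q => cc q) q hq.
  exists (val (c (- d%:Z) f : conc (kdual S) _)).
  by apply: (cinj _ f); rewrite hZ; apply: val_inj.
Qed.
Lemma to_deg0_cval (C : galg K) (i : int) (b : Defs.comp C i) :
  i = 0 -> val (to_deg0 (cval b)) = cval b.
Proof. by move=> i0; move: b; rewrite i0 => b; apply/eqP; exact: (valP b). Qed.

(** Evaluating these cocycles at the generators y k of P_d gives maps D(S) -> S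
that separate points, whence a dual basis (psi k, m k) of D(S) by
[kdual_dual_basis]. In terms of cocycles it says q = sum_k q(y k) Z(m k), hence
q e = q for e(w) = sum_k (y k) Z(m k)(w). *)
Lemma top_endomorphism : kdual_projective S /\
  exists e : gmor (P d) (P d),
  [/\ forall j x, e j (pdiff P d j x) = 0,
      forall j x, e j (e j x) = e j x &
      forall q : gdual (P d) (- d%:Z), cocyc q -> gcomp q e = q].
Proof.
have [Z [Zlin Z0 Zc Zsurj]] := top_cocycles_kdual.
have [r [y [f hyf]]] := res_dual_basis d.
have dd : d%:Z - d%:Z = 0 by rewrite subrr.
pose phi k (x : kdual S) : S^o := to_deg0 (dval (Z x) (y k)).
have phiE k x : val (phi k x) = dval (Z x) (y k) by apply: to_deg0_cval.
have philin k : linear (phi k).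
  move=> a x x'; apply: (@val_inj _ _ (deg0 B)).
  rewrite phiE Zlin.
  transitivity (val a * dval (Z x) (y k) + dval (Z x') (y k)); first by [].
  by rewrite -!phiE.
have [psi psiE] : exists psi : 'I_r -> {linear kdual S -> S^o},
    forall k x, val (psi k x) = dval (Z x) (y k).
  by exists (fun k => linear_of (philin k)) => k x; exact: phiE.
have psisep x : (forall k, psi k x = 0) -> x = 0.
  move=> h; apply: Z0; apply: dval_inj => j w.
  rewrite (dual_basis_dval hyf) big1 => [//|k _].
  by rewrite -psiE h mul0r.
have [m hm] := @kdual_dual_basis K S r psi psisep.
split; first by exists r, psi, m.
have Zexp x j w : dval (Z x) (j := j) w = \sum_k dval (Z x) (y k) * dval (Z (m k)) w.
  have Zsum I (s : seq I) (F : I -> kdual S) (a : I -> S) :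
      dval (Z (\sum_(k <- s) a k *: F k)) w = \sum_(k <- s) val (a k) * dval (Z (F k)) w.
    elim: s => [|k s IHs]; last by rewrite !big_cons Zlin -IHs.
    rewrite !big_nil; have := Zlin 1 0 0; rewrite scaler0 addr0.
    have -> : gact (add0r _) ((1 : S) : Defs.comp B 0) (Z 0) = Z 0.
      by apply: dval_inj => i v; rewrite dval_act /cval /= mul1r.
    by move=> /(congr1 (fun q => q - Z 0)); rewrite subrr addrK => <-.
  rewrite {1}(hm x) Zsum; apply: eq_bigr => k _; congr (_ * _).
  exact: psiE.
have qexp (q : gdual (P d) (- d%:Z)) : cocyc q -> forall j w,
    dval q (j := j) w = \sum_k dval q (y k) * dval (Z (m k)) w.
  by move=> hq j w; have [x <-] := Zsurj q hq; exact: Zexp.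
pose e : gmor (P d) (P d) := \sum_k gcomp (orbit_map (y k)) (Z (m k)).
have eE j w : e j w = \sum_k orbit_map (y k) j (Z (m k) j w) by rewrite sum_gmorE.
have qe (q : gdual (P d) (- d%:Z)) : cocyc q -> gcomp q e = q.
  move=> hq; apply: dval_inj => j w; rewrite (qexp q hq j w).
  rewrite [LHS]/(dval q (e j w)) eE.
  rewrite {1}/dval gmor_sum cval_sum; apply: eq_bigr => k _.
  exact: dval_orbit.
exists e; split=> // j w.
  rewrite eE big1 // => k _; rewrite (Zc (m k) j w); exact: gmor0.
rewrite (eE j (e j w)) (eE j w); apply: eq_bigr => k _; rewrite -eE.
congr (orbit_map (y k) j _).
exact: (congr1 (fun q : gmor _ _ => q j w) (qe _ (Zc (m k)))).
Qed.

(** Descending from d: the obstruction to extending the chain map from degree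
k + 1 to degree k is a class in Ext^(k+1)(S_B, P_k), which vanishes since k < d. *)
Lemma extend_endomorphism (e : gmor (P d) (P d)) :
  (forall j x, e j (pdiff P d j x) = 0) ->
  exists eps : forall n, gmor (P n) (P n),
  [/\ eps d = e, forall n, (d < n)%N -> eps n = 0 &
      forall n j x, pdiff P n j (eps n.+1 j x) = eps n j (pdiff P n j x)].
Proof.
move=> he.
suff claim t : (t <= d)%N -> exists eps : forall n, gmor (P n) (P n),
  [/\ eps d = e, forall n, (d < n)%N -> eps n = 0 &
      forall n, (d - t <= n)%N -> forall j x,
        pdiff P n j (eps n.+1 j x) = eps n j (pdiff P n j x)].
  have [eps [h1 h2 h3]] := claim d (leqnn d).
  by exists eps; split=> // n; apply: h3; rewrite subnn.
elim: t => [_|t IHt lt].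
  exists (dfwith (fun n => 0 : gmor (P n) (P n)) e); split.
  - by rewrite dfwith_in.
  - by move=> n lt; rewrite dfwith_out // neq_ltn lt.
  move=> n; rewrite subn0 leq_eqVlt => /orP[/eqP<- j x|lt j x].
    by rewrite dfwith_in dfwith_out ?gmor0 ?he // neq_ltn ltnSn.
  by rewrite !dfwith_out ?neq_ltn ?lt ?(ltnW lt) ?gmor0 // ltnS ltnW.
have [eps [epsd eps0 epsc]] := IHt (ltnW lt).
set k := (d - t.+1)%N.
have kS : k.+1 = (d - t)%N by rewrite /k subnSK.
have kd : (k < d)%N by rewrite kS leq_subr.
have [|j x|h hh] := @endo_coboundary k.+1 k (gcomp (pdiff P k) (eps k.+1)).
- by rewrite (ltn_eqF kd) orbT.
- by rewrite /= -epsc ?kS // pdiff_pdiff.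
exists (dfwith eps h); split=> [|n ltn|n].
- by rewrite dfwith_out // ltn_eqF.
- by rewrite dfwith_out ?eps0 // ltn_eqF // (ltn_trans kd).
rewrite leq_eqVlt => /orP[/eqP<- j x|lt' j x].
  rewrite dfwith_in dfwith_out; last by rewrite ltn_eqF.
  by have := congr1 (fun q : gmor _ _ => q j x) hh.
have nk : k != n by rewrite ltn_eqF.
have nk1 : k != n.+1 by rewrite ltn_eqF // leqW.
by rewrite !dfwith_out //; apply: epsc; rewrite -kS.
Qed.

(** Evaluation at an element of degree 0 of P_0, a map of left modules from the
dual of P_0 to B. *)
Section Evaluation.
Variable x : P 0 0.
Fact evaluation_deg u : (0 : int) + u = u. Proof. exact: add0r. Qed.
Definition ev_fun u (q : gdual (P 0) u) : bmod1 (reg B) u :=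
  ccast (evaluation_deg u) (q 0 x).
Fact ev_funD u : {morph @ev_fun u : q q' / q + q'}.
Proof. by move=> q q'; apply: cval_inj. Qed.
Fact ev_fun_act (i j k : int) (e : i + j = k) b (q : gdual (P 0) j) :
  ev_fun (gact e b q : gdual (P 0) k) = gact e b (ev_fun q).
Proof. exact: cval_inj. Qed.
Definition ev_map : gmor (gdual (P 0)) (bmod1 (reg B)) := Gmor ev_funD ev_fun_act.
End Evaluation.

(** The hypotheses make eta zero on the cohomology of Hom(P, B). For x in the
image of eta in degree 0, evaluation at x is therefore a map from the dual of
P_0 to B that factors through the dual of P_1 by [injdim_factor]. The latter is
generated in degree -1, where B vanishes, so that x = 0. Linearity of P then
propagates eta = 0 from P_0 to all P_n. *)
Lemma complementary_endomorphism_eq0 (eta : forall n, gmor (P n) (P n)) :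
  (forall n j x, pdiff P n j (eta n.+1 j x) = eta n j (pdiff P n j x)) ->
  (forall n j x, eta n j (eta n j x) = eta n j x) ->
  (forall q : gdual (P d) (- d%:Z), cocyc q -> gcomp q (eta d) = 0) ->
  forall n j x, eta n j x = 0.
Proof.
move=> etac etai etad.
have chain n j (h : gdual (P n) j) :
    gcomp (gcomp h (pdiff P n)) (eta n.+1) = gcomp (gcomp h (eta n)) (pdiff P n).
  by apply: gmorP => i x /=; rewrite etac.
have cob n j (q : gdual (P n) j) : cocyc q -> is_coboundary (gcomp q (eta n)).
  case: (boolP ((n != d) || (j != - d%:Z))) => [hnj hq|].
    have := cocycle_coboundary hnj hq.
    case: n q {hnj hq} => [|n] q /=; first by move=> ->; apply: gmorP.
    by move=> [h ->]; exists (gcomp h (eta n)); rewrite chain.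
  rewrite negb_or !negbK => /andP[/eqP en /eqP ej]; subst n j => hq.
  by rewrite etad //; exact: is_coboundary0.
have dl0 n j (q : gdual (P n) j) : gdual_map (pdiff P n) j q = 0 -> cocyc q.
  by move=> h i x; exact: (congr1 (fun g : gmor _ _ => g i x) h).
(* Evaluation at x', fixed by eta, vanishes on the dual of P_0, which separates
   points thanks to the coordinate maps. *)
have eta00 : forall x : P 0 0, eta 0 0 x = 0.
  move=> x; set x' := eta 0 0 x.
  have [r [y [f hyf]]] := res_dual_basis 0.
  suff ev0 u (q : gdual (P 0) u) : q 0 x' = 0.
    by rewrite [x']hyf big1 // => k _; rewrite (ev0 _ (f k)); exact: gmor0.
  have [|||||||kap hkap] := @injdim_factor K B (bmod1 (reg B)) d
    (fun n => gdual (P n)) (fun n => gdual_map (pdiff P n))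
    (fun n => gdual_map (eta n)) _ _ _ _ _ _ (ev_map x') hinj.
  - by move=> n; have [s [z [g hzg]]] := res_dual_basis n; exact: gdual_proj hzg.
  - by move=> n j g; apply: gmorP => i z /=; rewrite pdiff_pdiff gmor0.
  - by move=> n j g; rewrite /= -chain.
  - by move=> n j g; apply: gmorP => i z /=; rewrite etai.
  - by move=> j g /dl0 /cob.
  - by move=> n j g /dl0 /cob[h hh]; exists h.
  - by move=> j g; apply: cval_inj; rewrite /= /ev_fun /cval /= etai.
  have [s [z [g hzg]]] := res_dual_basis 1.
  (* kap sends the generators, of degree -1, to B_(-1) = 0. *)
  have kap0 j w : kap j w = 0.
    by apply: (gen_mor0 (gdual_gen hzg)) => {}w; exact: comp_neg.
  have := hkap u q; rewrite kap0 => /(congr1 (@cval K B u)) h.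
  by apply: cval_inj; exact: esym h.
elim=> [|n IHn]; first exact: gen_mor0 (hP 0) eta00.
apply: (gen_mor0 (hP n.+1)) => x.
have : pdiff P n _ (eta n.+1 _ x) = 0 by rewrite etac IHn.
move=> /pexactP[z <-].
by rewrite (gen_low z (hP n.+2)) ?gmor0 // ltz_nat.
Qed.

(** Extend the endomorphism e of P_d to an endomorphism eps of P that is zero
above d. It is idempotent because its defect below d is killed by
[endo_cocycle_eq0], and its complement is zero, so that the identity of P_n is
zero for n > d. *)
Theorem finite_linear_resolution :
  kdual_projective S /\ forall n, (d < n)%N -> gzero (P n).
Proof.
have [hproj [e [e0 ei qe]]] := top_endomorphism.
split=> //; have [eps [epsd eps0 epsc]] := extend_endomorphism e0.
have epsi n j x : eps n j (eps n j x) = eps n j x.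
  have [lt|le] := ltnP d n; first by rewrite eps0.
  have [t ht] : exists t, (n + t)%N = d by exists (d - n)%N; rewrite subnKC.
  elim: t n le ht j x => [|t IHt] n le ht j x.
    by move: ht j x; rewrite addn0 => -> j x; rewrite epsd ei.
  pose g := gcomp (eps n) (eps n) - eps n.
  suff /(congr1 (fun h : gmor _ _ => h j x))/eqP : g = 0 by rewrite subr_eq0 => /eqP.
  apply: endo_cocycle_eq0 => [|i z].
    by rewrite neq_ltn -ht addnS ltnS leq_addr.
  rewrite [LHS]/(eps n i (eps n i (pdiff P n i z)) - eps n i (pdiff P n i z)).
  have hn1 : (n.+1 <= d)%N by rewrite -ht addnS ltnS leq_addr.
  have hn2 : (n.+1 + t)%N = d by rewrite addSnnS.
  by rewrite -!epsc (IHt n.+1 hn1 hn2); exact: subrr.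
pose eta n := gid (P n) - eps n.
have eta0 : forall n j x, eta n j x = 0.
  apply: complementary_endomorphism_eq0 => [n j x|n j x|q hq].
  - by rewrite gmorB epsc.
  - by rewrite /= gmorB epsi subrr subr0.
  - apply: gmorP => j x.
    have -> : gcomp q (eta d) j x = q j x - q j (eps d j x) by exact: gmorB.
    rewrite epsd.
    have qex : q j (e j x) = q j x := congr1 (fun g : gmor _ _ => g j x) (qe q hq).
    by rewrite qex; exact: subrr.
move=> n lt j x; have := eta0 n j x.
by rewrite /= eps0 // subr0.
Qed.

End Core.

(** * Linear resolutions *)

Section LinearResolutions.
Variables (K : fieldType) (B : galg K).
Implicit Types L M N : gmod B.

Definition linear_res M (a : int) (len : nat) : Prop :=
  exists P : proj_res M, (forall n : nat, generated_in (P n) (a + n%:Z)) /\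
    (forall n, (len <= n)%N -> gzero (P n)).

Lemma linear_res_zero M a : gzero M -> linear_res M a 0.
Proof.
move=> M0.
have Mproj : gprojective M.
  by move=> L N p f _; exists 0 => j x; rewrite [x]M0 !gmor0.
have ex0 : @gexact _ _ M M M 0 0.
  by move=> j y; split=> [_|]; [exists 0; rewrite [y]M0 gmor0|].
have surj0 : @gsurj _ _ M M 0 by move=> j y; exists 0; rewrite [y]M0 gmor0.
exists (@ProjRes _ _ M (fun=> M) (fun=> 0) 0 (fun=> Mproj) surj0 ex0 (fun=> ex0)).
by split=> // n; apply: gen_zero.
Qed.

(** Z is the kernel of f up to isomorphism, and R resolves it. *)
Section Splice.
Variables (M Z P0 : gmod B) (f : gmor P0 M) (i : gmor Z P0) (R : proj_res Z).
Hypotheses (fsurj : gsurj f) (P0proj : gprojective P0).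
Hypotheses (iinj : ginj i) (iex : gexact i f).

Definition splice_term n : gmod B := if n is m.+1 then R m else P0.
Definition splice_diff n : gmor (splice_term n.+1) (splice_term n) :=
  match n return gmor (splice_term n.+1) (splice_term n) with
  | 0 => gcomp i (paug R)
  | m.+1 => pdiff R m
  end.
Fact splice_proj n : gprojective (splice_term n).
Proof. by case: n => [|n]; [exact: P0proj|exact: (@pterm_proj _ _ _ R n)]. Qed.
Fact splice_exact0 : gexact (splice_diff 0) (f : gmor (splice_term 0) M).
Proof.
move=> j y; split=> [/(iex y)[z <-]|[x <-]].
  by have [x <-] := @paug_surj _ _ _ R _ z; exists x.
by apply/(iex _); exists (paug R j x).
Qed.
Fact splice_exact n : gexact (splice_diff n.+1) (splice_diff n).
Proof.
case: n => [|n] j y; last exact: (@pexact _ _ _ R n j y).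
rewrite -[X in _ <-> X](@pexact0 _ _ _ R j y).
split=> [|h]; last by rewrite /= h gmor0.
by rewrite -(gmor0 i) => /iinj.
Qed.
Definition splice : proj_res M :=
  ProjRes splice_proj (fsurj : gsurj (f : gmor (splice_term 0) M))
    splice_exact0 splice_exact.
End Splice.

Lemma linear_res_splice M Z P0 (f : gmor P0 M) (i : gmor Z P0) a len :
  gsurj f -> gprojective P0 -> generated_in P0 a -> ginj i -> gexact i f ->
  linear_res Z (a + 1) len -> linear_res M a len.+1.
Proof.
move=> fsurj P0proj P0gen iinj iex [R [Rgen R0]].
exists (splice R fsurj P0proj iinj iex); split=> [[|n]|[|n]] //=.
- by rewrite addr0.
- by have := Rgen n; rewrite -addrA -intS.
- exact: R0.
Qed.

Lemma linear_res_iso M M' (f : gmor M M') a len : (forall j, bijective (f j)) ->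
  linear_res M a len -> linear_res M' a len.
Proof.
move=> fbij [P hP].
have surj : gsurj (gcomp f (paug P)).
  move=> j y; have [g fK gK] := fbij j.
  by have [x hx] := @paug_surj _ _ _ P _ (g y); exists x; rewrite /= hx gK.
have ex0 : gexact (pdiff P 0) (gcomp f (paug P)).
  move=> j y; rewrite -[X in _ <-> X](@pexact0 _ _ _ P j y) /=.
  split=> [|->]; last exact: gmor0.
  by rewrite -(gmor0 f) => /(bij_inj (fbij j)).
by exists (ProjRes (@pterm_proj _ _ _ P) surj ex0 (@pexact _ _ _ P)).
Qed.

(** Transport along an equality of degrees, realised by the action of 1: this
makes it commute with actions and with morphisms. *)
Definition gcast M (i j : int) (e : 0 + i = j) (x : M i) : M j := gact e (cone B) x.

Lemma gact_cast M (i j k j' : int) (e : i + j = k) (e' : 0 + j = j') (e2 : i + j' = k)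
    b (x : M j) :
  gact e2 b (gcast e' x) = gact e b x.
Proof.
rewrite /gcast -(act_mul (gactP M) (addr0 i) e).
by congr (gact _ _ x); apply: val_inj; rewrite /= mulr1.
Qed.

Lemma gcast_act M (i j k k' : int) (e : i + j = k) (e' : 0 + k = k') (e2 : i + j = k')
    b (x : M j) :
  gcast e' (gact e b x) = gact e2 b x.
Proof.
rewrite /gcast -(act_mul (gactP M) (add0r i) e2).
by congr (gact _ _ x); apply: val_inj; rewrite /= mul1r.
Qed.

Lemma gcastD M (i j : int) (e : 0 + i = j) : {morph @gcast M i j e : x y / x + y}.
Proof. by move=> x y; rewrite /gcast (act_addr (gactP M)). Qed.

Lemma gcastK M (i j : int) (e : 0 + i = j) (e' : 0 + j = i) (x : M i) :
  gcast e' (gcast e x) = x.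
Proof.
rewrite [LHS](gcast_act e e' (add0r i)).
exact: (act_one (gactP M)).
Qed.

Fact cast_to_shift (j n : int) : 0 + j = j - n + n. Proof. by rewrite add0r subrK. Qed.
Fact cast_of_shift (j n : int) : 0 + (j - n + n) = j. Proof. by rewrite add0r subrK. Qed.

Fact cast_of_shift' (j n : int) : 0 + (j + n - n) = j. Proof. by rewrite add0r addrK. Qed.

Section ShiftMap.
Variables (M N : gmod B) (f : gmor M N) (n : int).
Definition gshift : gmor (shift M n) (shift N n) :=
  @Gmor K B (shift M n) (shift N n) (fun j => f (j + n))
    (fun j => @gfunD _ _ _ _ f (j + n))
    (fun i j k e b x => gfun_act f (shift_eq n e) b x).
End ShiftMap.

(** Lifting problems for M(n) are those for M after shifting the targets by -n. *)
Lemma shift_proj M n : gprojective M -> gprojective (shift M n).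
Proof.
move=> hM L N p f psurj.
have fD j :
    {morph (fun x : M j =>
       f (j - n) (gcast (cast_to_shift j n) x) : shift N (- n) j) : x y / x + y}.
  by move=> x y; rewrite gcastD gfunD.
have fA (i j k : int) (e : i + j = k) b (x : M j) :
    f (k - n) (gcast (cast_to_shift k n) (gact e b x)) =
    gact (g := shift N (- n)) e b (f (j - n) (gcast (cast_to_shift j n) x)).
  apply: etrans (gfun_act f (shift_eq (- n) e) b _); congr (f _ _).
  have e2 : i + j = k - n + n by rewrite e subrK.
  rewrite (gcast_act _ _ e2); apply/esym.
  exact: (@gact_cast M _ _ _ _ e2 (cast_to_shift j n) (shift_eq n (shift_eq (- n) e)) b x).
have [|h hh] := hM _ _ (gshift p (- n)) (Gmor fD fA).
  by move=> j y; exact: psurj.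
have hD j :
    {morph (fun x : M (j + n) => gcast (cast_of_shift' j n) (h (j + n) x)) : x y / x + y}.
  by move=> x y; rewrite gfunD gcastD.
have hA (i j k : int) (e : i + j = k) b (x : shift M n j) :
    gcast (cast_of_shift' k n) (h (k + n) (gact e b x)) =
    gact e b (gcast (cast_of_shift' j n) (h (j + n) x)).
  rewrite [gact e b x]/(gact (shift_eq n e) b (x : M (j + n))) gfun_act.
  have e2 : i + (j + n - n) = k by rewrite addrK.
  by rewrite [LHS](gcast_act _ _ e2); apply/esym; exact: gact_cast.
exists (@Gmor _ _ (shift M n) L _ hD hA) => j x /=.
rewrite /gcast gfun_act.
have -> : p _ (h (j + n) x) = f (j + n - n) (gcast (cast_to_shift (j + n) n) x) by exact: hh.
rewrite -gfun_act; congr (f j _).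
exact: (gcastK (cast_to_shift (j + n) n) (shift_eq n (cast_of_shift' j n)) x).
Qed.

Lemma shift_gen M (a n : int) : generated_in M a -> generated_in (shift M n) (a - n).
Proof.
move=> hM i k e x.
have e1 : i + a = k + n by rewrite -e addrA subrK.
have [r [b [m hx]]] := hM _ _ e1 x.
exists r, b, (fun t => gcast (cast_to_shift a n) (m t)); rewrite {1}hx.
apply: eq_bigr => t _; apply/esym.
exact: (@gact_cast M _ _ _ _ e1 (cast_to_shift a n) (shift_eq n e) (b t) (m t)).
Qed.

Lemma linear_res_shift M a len n :
  linear_res M a len -> linear_res (shift M n) (a - n) len.
Proof.
move=> [P [Pgen P0]].
have surj : gsurj (gshift (paug P) n) by move=> j; exact: (@paug_surj _ _ _ P (j + n)).
have ex0 : gexact (gshift (pdiff P 0) n) (gshift (paug P) n).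
  by move=> j; exact: (@pexact0 _ _ _ P (j + n)).
have ex m : gexact (gshift (pdiff P m.+1) n) (gshift (pdiff P m) n).
  by move=> j; exact: (@pexact _ _ _ P m (j + n)).
exists (@ProjRes _ _ _ (fun m => shift (P m) n) _ _
  (fun m => @shift_proj _ n (@pterm_proj _ _ _ P m)) surj ex0 ex); split=> m /=.
  by rewrite addrAC; apply: shift_gen.
by move=> /P0 z j x; exact: z.
Qed.

Lemma linear_res_unshift M a n len :
  linear_res (shift M n) (a - n) len -> linear_res M a len.
Proof.
move=> /(@linear_res_shift _ _ _ (- n)); rewrite opprK subrK.
have fD j : {morph (fun x : M (j - n + n) => gcast (cast_of_shift j n) x) : x y / x + y}.
  exact: gcastD.
have fA (i j k : int) (e : i + j = k) b (x : shift (shift M n) (- n) j) :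
    gcast (cast_of_shift k n) (gact e b x) = gact e b (gcast (cast_of_shift j n) x).
  have e2 : i + (j - n + n) = k by rewrite subrK.
  by rewrite [LHS](gcast_act _ _ e2); apply/esym; exact: gact_cast.
apply: (@linear_res_iso _ _ (@Gmor _ _ (shift (shift M n) (- n)) M _ fD fA)) => j.
by exists (gcast (cast_to_shift j n)) => x; exact: gcastK.
Qed.

Definition gpow_map m M N (f : gmor M N) : gmor (gpow m M) (gpow m N) :=
  pow_pair (fun t => gcomp f (pow_proj M t)).

Lemma gpow_proj m M : gprojective M -> gprojective (gpow m M).
Proof.
move=> hM L N p f psurj.
have /choice[h hh] t := hM _ _ p (gcomp f (pow_inj M t)) psurj.
exists (\sum_t gcomp (h t) (pow_proj M t)) => j x.
rewrite sum_gmorE gmor_sum [in RHS](pow_inj_sum x) gmor_sum.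
by apply: eq_bigr => t _; rewrite /= hh.
Qed.

Lemma gpow_exact m L M N (f : gmor L M) (g : gmor M N) :
  gexact f g -> gexact (gpow_map m f) (gpow_map m g).
Proof.
move=> ex j y; split=> [/ffunP h|[x <-]].
  have /choice[x hx] t : exists x, f j x = y t.
    by apply/ex; have := h t; rewrite !ffunE.
  by exists [ffun t => x t]; apply/ffunP => t; rewrite ffunE /= ffunE hx.
by apply/ffunP => t; rewrite !ffunE /=; apply/ex; exists (x t); rewrite ffunE.
Qed.

Lemma linear_res_pow m M a len : linear_res M a len -> linear_res (gpow m M) a len.
Proof.
move=> [P [Pgen P0]].
have surj : gsurj (gpow_map m (paug P)).
  move=> j y; have /choice[x hx] t := @paug_surj _ _ _ P _ (y t).
  by exists [ffun t => x t]; apply/ffunP => t; rewrite !ffunE /= ffunE hx.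
exists (@ProjRes _ _ _ (fun n => gpow m (P n)) (fun n => gpow_map m (pdiff P n))
  (gpow_map m (paug P)) (fun n => gpow_proj (@pterm_proj _ _ _ P n)) surj
  (gpow_exact (@pexact0 _ _ _ P)) (fun n => gpow_exact (@pexact _ _ _ P n))).
split=> n /=; first exact: gen_pow.
by move=> /P0 z j x; apply/ffunP => t; rewrite [LHS]z [RHS]z.
Qed.

(** Along a linear resolution lifts are unique, not only up to homotopy: the
generators of P_n have a degree in which P_(n+1) vanishes. *)
Lemma linear_chain_eq0 M (P : proj_res M) a (G : forall n, gmor (P n) (P n)) :
  (forall n : nat, generated_in (P n) (a + n%:Z)) ->
  (forall j x, paug P j (G 0 j x) = 0) ->
  (forall n j x, pdiff P n j (G n.+1 j x) = G n j (pdiff P n j x)) ->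
  forall n j x, G n j x = 0.
Proof.
move=> Pgen G0 GS.
have low n (z : P n.+1 (a + n%:Z)) : z = 0.
  by apply: gen_low (Pgen n.+1) _; rewrite ltrD2l ltz_nat.
elim=> [|n IHn].
  apply: (gen_mor0 (Pgen 0)) => x; have /pexact0P[z <-] := G0 _ x.
  by rewrite (low _ z) gmor0.
apply: (gen_mor0 (Pgen n.+1)) => x.
have : pdiff P n _ (G n.+1 _ x) = 0 by rewrite GS IHn.
by move=> /pexactP[z <-]; rewrite (low _ z) gmor0.
Qed.

(** The idempotent i r of M lifts to a chain map E of P, which is idempotent by
uniqueness of lifts; its image resolves M'. *)
Lemma linear_res_retract M M' (i : gmor M' M) (r : gmor M M') a len :
  (forall j x, r j (i j x) = x) -> linear_res M a len -> linear_res M' a len.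
Proof.
move=> ri [P [Pgen P0]].
have [E [hE0 hE]] := chain_lift (gcomp i r) P P.
have Eidem n j x : E n j (E n j x) = E n j x.
  apply/eqP; rewrite -subr_eq0; apply/eqP.
  apply: (@linear_chain_eq0 _ P a (fun n => gcomp (E n) (E n) - E n)) => // [|m] {}j {}x.
    by rewrite gmorB /= !hE0 /= ri subrr.
  by rewrite gmorB /= !hE.
pose X n := gsub (gimage (E n)).
have XE n j (x : X n j) : E n j (val x) = val x.
  by have [y <-] := gsubP x; rewrite Eidem.
pose q n : gmor (P n) (X n) :=
  gcor (U := gimage (E n)) (f := E n) (fun j x => ex_intro _ x erefl).
have qi n j (x : X n j) : q n j (val x) = x by apply: val_inj; rewrite /= XE.
have Xproj n : gprojective (X n).
  move=> L N p f psurj.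
  have [h hh] := @pterm_proj _ _ _ P n _ _ p (gcomp f (q n)) psurj.
  by exists (gcomp h (gincl _)) => j x; rewrite [LHS]hh; congr (f j _); exact: qi.
pose dX n : gmor (X n.+1) (X n) := gcomp (q n) (gcomp (pdiff P n) (gincl _)).
have dXE n j (x : X n.+1 j) : val (dX n j x) = pdiff P n j (val x).
  by rewrite /= -hE XE.
pose aX : gmor (X 0) M' := gcomp r (gcomp (paug P) (gincl _)).
have asurj : gsurj aX.
  move=> j y; have [z hz] := @paug_surj _ _ _ P _ (i j y).
  by exists (q 0 j z); rewrite /= hE0 /= hz !ri.
have aex : gexact (dX 0) aX.
  move=> j y; split=> [h|[x <-]].
    have : paug P j (val y) = 0 by rewrite -XE hE0 /= [r _ _]h gmor0.
    move=> /pexact0P[z hz]; exists (q 1 j z); apply: val_inj.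
    by rewrite dXE /= hE hz XE.
  have -> : aX j (dX 0 j x) = r j (paug P j (pdiff P 0 j (val x))) by rewrite -dXE.
  by rewrite paug_pdiff; exact: gmor0.
have dex n : gexact (dX n.+1) (dX n).
  move=> j y; split=> [/(congr1 val)|[x <-]].
    rewrite dXE => /pexactP[z hz]; exists (q n.+2 j z); apply: val_inj.
    by rewrite dXE /= hE hz XE.
  by apply: val_inj; rewrite !dXE pdiff_pdiff.
exists (ProjRes Xproj asurj aex dex); split=> n /=.
  by apply: (gen_image (f := q n)) (Pgen n) => j x; exists (val x).
by move=> /P0 z j x; apply: val_inj; rewrite [LHS]z [RHS]z.
Qed.

Lemma linear_res_summand M M' m (i : 'I_m -> gmor M' M) (r : 'I_m -> gmor M M') a len :
  (forall j x, x = \sum_k r k j (i k j x)) -> linear_res M a len -> linear_res M' a len.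
Proof.
move=> hir /(linear_res_pow m).
apply: (@linear_res_retract _ _ (pow_pair i) (\sum_k gcomp (r k) (pow_proj M k))).
by move=> j x; rewrite [RHS]hir sum_gmorE; apply: eq_bigr => k _; rewrite /= ffunE.
Qed.

Lemma linear_res_koszul M len : linear_res M 0 len -> koszul_module M.
Proof. by move=> [P [Pgen _]]; exists P => n; rewrite -[n%:Z]add0r. Qed.

Lemma linear_res_pdim M a d : linear_res M a d.+1 -> pdim_le M d.
Proof. by move=> [P [_ P0]]; exists P. Qed.

(** The identity of M is a sum of maps through M'. If a resolution of M' vanishes
at d, the lift of this sum is zero in degree d, while it is homotopic to the
identity; so every cocycle of degree d is a coboundary. *)
Lemma pdim_ge_ext (B' : galg K) M M' (N : gbimod B B') (E : gmod B') (d n : nat)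
    m (i : 'I_m -> gmor M M') (r : 'I_m -> gmor M' M) :
  (forall j x, x = \sum_k r k j (i k j x)) ->
  ext_isom d M N E -> ~ gzero E -> pdim_le M' n -> (d <= n)%N.
Proof.
move=> hir hE nE [R R0]; rewrite leqNgt; apply/negP => lt; apply: nE.
have [P _] := hE; have [c [_ _ c0 csurj]] := ext_isom_classes hE P.
have /choice[I hI] k := chain_lift (i k) P R.
have /choice[J hJ] k := chain_lift (r k) R P.
pose G n := gid (P n) - \sum_k gcomp (J k n) (I k n).
have G0 j x : paug P j (G 0 j x) = 0.
  rewrite [G 0 j x]/(x - (\sum_k gcomp (J k 0) (I k 0)) j x) gmorB sum_gmorE gmor_sum.
  apply/eqP; rewrite subr_eq0 {1}[paug P j x]hir; apply/eqP/eq_bigr => k _.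
  by have [-> _] := hJ k; have [-> _] := hI k.
have GS k j x : pdiff P k j (G k.+1 j x) = G k j (pdiff P k j x).
  rewrite [G k.+1 j x]/(x - (\sum_l gcomp (J l k.+1) (I l k.+1)) j x) gmorB sum_gmorE gmor_sum.
  rewrite [RHS]/(_ - _ j _) sum_gmorE; congr (_ - _); apply: eq_bigr => l _ /=.
  by have [_ ->] := hJ l; have [_ ->] := hI l.
have Gd : G d = gid (P d).
  apply: gmorP => j x; rewrite [LHS]/(x - (\sum_l gcomp (J l d) (I l d)) j x) sum_gmorE.
  rewrite big1 => [|l _]; first exact: subr0.
  by rewrite /= (R0 d lt j (I l d j x)) gmor0.
move=> j x; have [f <-] := csurj j x; apply/c0.
have /cocycleP hf := valP f.
have := null_homotopic_cocycle G0 GS hf; rewrite Gd.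
by congr is_coboundary; apply: gmorP.
Qed.

End LinearResolutions.

(** * The resolutions of D(S) *)

Section DualResolution.
Variables (K : fieldType) (B : galg K) (d : nat).
Local Notation RB := (bswap (reg B)).
Variable P : proj_res (gS (op B)).
Hypothesis hP : forall n : nat, generated_in (P n) n.
Arguments hP : clear implicits.
Hypothesis ext0 : forall n : nat, n != d -> ext_zero n (gS (op B)) RB.
Hypothesis extd : ext_isom d (gS (op B)) RB (shift (gDS B) d).
Hypothesis P0 : forall n, (d < n)%N -> gzero (P n).

(** These submodules are the kernels at which the dual complex is cut into short
exact sequences. *)
Definition coboundaries n : submod (gdual (P n)) :=
  @Submod K B (gdual (P n)) (fun u q => is_coboundary q)
    (fun u => is_coboundary0 P _ n) (fun u q q' => @is_coboundaryB _ _ _ P _ n q q')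
    (fun i j k e b q => @is_coboundary_post _ _ _ _ P RB n i j k e b q).

(** Below d the dual complex is exact, so that the coboundaries in degree m are the
kernel of the map from the dual of P_m onto the coboundaries in degree m + 1. *)
Lemma coboundaries_linear_res m : (m <= d)%N ->
  linear_res (gsub (coboundaries m)) (- m%:Z + 1) m.
Proof.
elim: m => [_|m IHm lt].
  by apply: linear_res_zero => j x; apply: val_inj; exact: (gsubP x).
have [r [y [f hyf]]] := res_dual_basis hP m.
have cob j (q : gdual (P m) j) : is_coboundary (gdual_map (pdiff P m) j q).
  by exists q.
have -> : - m.+1%:Z + 1 = - m%:Z by rewrite intS opprD addrAC addNr add0r.
apply: (@linear_res_splice _ _ _ _ _ (gcor (U := coboundaries m.+1) cob)
  (gincl (coboundaries m))).
- by move=> j x; have [q hq] := gsubP x; exists q; apply: val_inj.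
- exact: gdual_proj hyf.
- exact: gdual_gen hyf.
- by move=> j; exact: val_inj.
- move=> j q; split=> [/(congr1 val) h|[x <-]].
    have hq : is_coboundary q.
      apply: (cocycle_coboundary ext0 extd); first by rewrite ltn_eqF.
      by move=> i z; exact: (congr1 (fun g : gmor _ _ => g i z) h).
    by exists (gsub_of (U := coboundaries m) hq).
  apply: val_inj; apply: gmorP => i z.
  exact: (coboundary_cocycle z (gsubP x)).
- exact: IHm (ltnW lt).
Qed.

(** As P_(d+1) = 0, all cochains of degree d are cocycles, and the dual of P_d maps
onto D(S)(d) with kernel the coboundaries. Hence the dual complex resolves
D(S)(d), linearly. *)
Lemma kdual_linear_res : linear_res (gDS B) 0 d.+1.
Proof.
have [c [cB cA c0 csurj]] := ext_isom_classes extd P.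
have top_cocycle u (q : gdual (P d) u) :
    (q : cochain P RB d u) \in @cocycle_pred _ _ _ _ P RB d u.
  by apply/cocycleP => i x; rewrite (P0 (ltnSn d) x) (gmor0 (pdiff P d)); exact: gmor0.
pose z u (q : gdual (P d) u) : cocycle P RB d u :=
  exist (fun q => q \in @cocycle_pred _ _ _ _ P RB d u) q (top_cocycle u q).
pose C u (q : gdual (P d) u) : shift (gDS B) d u := c u (z u q).
have CB u : {morph @C u : q q' / q - q'}.
  by move=> q q'; rewrite /C -cB; congr (c u _); exact: val_inj.
have C00 u : C u 0 = 0 by rewrite -(subrr 0) CB subrr.
have CD u : {morph @C u : q q' / q + q'}.
  by move=> q q'; rewrite -{1}(opprK q') CB -(sub0r q') CB C00 sub0r opprK.
have CA (i j k : int) (e : i + j = k) b (q : gdual (P d) j) :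
    C k (gact e b q) = gact e b (C j q).
  by rewrite /C -cA; congr (c k _); exact: val_inj.
have [r [y [f hyf]]] := res_dual_basis hP d.
apply: (@linear_res_unshift _ _ _ _ d); rewrite sub0r.
apply: (@linear_res_splice _ _ _ _ _ (Gmor CD CA) (gincl (coboundaries d))).
- move=> u x; have [q hq] := csurj u x; exists (val q).
  by rewrite -hq; congr (c u _); exact: val_inj.
- exact: gdual_proj hyf.
- exact: gdual_gen hyf.
- by move=> u; exact: val_inj.
- move=> u q; split=> [/c0 hq|[x <-]]; first by exists (gsub_of (U := coboundaries d) hq).
  by apply/c0; exact: (gsubP x).
- exact: coboundaries_linear_res (leqnn d).
Qed.

End DualResolution.

Section ConcentratedMaps.
Variables (K : fieldType) (B : galg K).

Section Map.
Variables (M N : lmodType (deg0 B)) (phi : {linear M -> N}).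
Fact conc_map_subproof j (x : conc M j) : phi (val x) \in conc_pred j.
Proof.
have := valP x; rewrite !unfold_in => /orP[->//|/eqP->].
by rewrite linear0 eqxx orbT.
Qed.
Definition conc_map_fun j (x : conc M j) : conc N j :=
  exist (fun y => y \in conc_pred j) _ (conc_map_subproof x).
Fact conc_map_funD j : {morph @conc_map_fun j : x y / x + y}.
Proof. by move=> x y; apply: val_inj; rewrite /= linearD. Qed.
Fact conc_map_fun_act (i j k : int) (e : i + j = k) b (x : conc M j) :
  conc_map_fun (gact e b x) = gact e b (conc_map_fun x).
Proof. by apply: val_inj; rewrite /= linearZ. Qed.
Definition conc_map : gmor (conc M) (conc N) := Gmor conc_map_funD conc_map_fun_act.
End Map.

Lemma conc_val_sum (M : lmodType (deg0 B)) j I (r : seq I) (F : I -> conc M j) :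
  val (\sum_(k <- r) F k : conc M j) = \sum_(k <- r) (val (F k) : M).
Proof. exact: (big_morph (fun x : conc M j => val x : M)). Qed.

Fact mul_linear (R : nzRingType) (M : lmodType R) (m : M) :
  linear (fun s : R^o => (s : R) *: m).
Proof. by move=> a x y; rewrite scalerDl scalerA. Qed.

Lemma gDS_summand : kdual_projective (deg0 B) ->
  exists m (i : 'I_m -> gmor (gDS B) (gS B)) (r : 'I_m -> gmor (gS B) (gDS B)),
    forall j x, x = \sum_k r k j (i k j x).
Proof.
move=> [n [f [m hfm]]].
exists n, (fun k => conc_map (f k)), (fun k => conc_map (linear_of (mul_linear (m k)))).
by move=> j x; apply: val_inj; rewrite [LHS](hfm (val x)) conc_val_sum.
Qed.

Lemma gS_summand : kdual_generates (deg0 B) ->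
  exists m (i : 'I_m -> gmor (gS B) (gDS B)) (r : 'I_m -> gmor (gDS B) (gS B)),
    forall j x, x = \sum_k r k j (i k j x).
Proof.
move=> [n [f [m hfm]]].
exists n, (fun k => conc_map (linear_of (mul_linear (m k)))), (fun k => conc_map (f k)).
move=> j x; apply: val_inj.
transitivity (\sum_k (f k ((val x : deg0 B) *: m k) : deg0 B)).
  under eq_bigr do rewrite linearZ.
  by rewrite -mulr_sumr hfm mulr1.
by rewrite conc_val_sum.
Qed.

(** Functionals separate 0 and 1 in S. *)
Lemma gDS_nonzero (l : int) : ~ gzero (shift (gDS B) l).
Proof.
move=> z; have /eqP := oner_neq0 (deg0 B); apply.
apply: (kdual_separates (deg0_finspan B)) => x; rewrite linear0.
have hx : x \in conc_pred (- l + l) by rewrite unfold_in addNr eqxx.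
by have /(congr1 val) /= -> := z (- l) (exist (fun y => y \in conc_pred _) x hx).
Qed.

End ConcentratedMaps.

Section OppositeDegreeZero.
Variables (K : fieldType) (B : galg K).

(** The degree 0 part of the opposite algebra is the opposite of S. *)
Definition deg0_op (s : deg0 B) : deg0 (op B) := exist _ (val s) (valP s).
Definition deg0_unop (s : deg0 (op B)) : deg0 B := exist _ (val s) (valP s).
Fact deg0_op_linear : linear deg0_op.
Proof. by move=> a x y; exact: (@val_inj _ _ (deg0 (op B))). Qed.
Fact deg0_opK : cancel deg0_op deg0_unop.
Proof. by move=> x; exact: (@val_inj _ _ (deg0 B)). Qed.
Fact deg0_unopK : cancel deg0_unop deg0_op.
Proof. by move=> x; exact: (@val_inj _ _ (deg0 (op B))). Qed.
Fact deg0_opM a b : linear_of deg0_op_linear (a * b) =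
  linear_of deg0_op_linear b * linear_of deg0_op_linear a.
Proof. exact: (@val_inj _ _ (deg0 (op B))). Qed.
Fact deg0_op1 : linear_of deg0_op_linear 1 = 1.
Proof. exact: (@val_inj _ _ (deg0 (op B))). Qed.

End OppositeDegreeZero.

Theorem lemma4p1p1 (K : fieldType) (B : galg K) (d : nat)
    (hB : standard_koszul_AS_gorenstein B d) :
  selfinjective (deg0 B) /\
  (koszul_module (gDS B) /\ pdim_eq (gDS B) d) /\
  (koszul_module (gDS (op B)) /\ pdim_eq (gDS (op B)) d).
Proof.
have [l [[[_ [hinj _]] [ext0 extd] [_ extd']] [_ _ [P hP]] el]] := hB; subst l.
have [Sproj P0] := finite_linear_resolution hP ext0 extd hinj.
have Sgen := kdual_projective_generates (deg0_finspan B) Sproj.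
have S'gen : kdual_generates (deg0 (op B)).
  exact: (@kdual_projective_anti K (deg0 B) (deg0 (op B))
    (linear_of (@deg0_op_linear K B)) (@deg0_unop K B) (deg0_finspan B)
    (@deg0_opK K B) (@deg0_unopK K B)
    (@deg0_opM K B) (@deg0_op1 K B) Sproj).
have S'proj : kdual_projective (deg0 (op B)).
  exact: (@kdual_generates_anti K (deg0 B) (deg0 (op B))
    (linear_of (@deg0_op_linear K B)) (@deg0_unop K B) (deg0_finspan B)
    (@deg0_opK K B) (@deg0_unopK K B)
    (@deg0_opM K B) Sgen).
(* Here the anti-isomorphism is the identity. *)
have Scgen : kdual_generates ((deg0 B)^c : algType K).
  exact: (@kdual_projective_anti K (deg0 B) ((deg0 B)^c) (idfun : {linear deg0 B -> deg0 B}) id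
    (deg0_finspan B) (fun=> erefl) (fun=> erefl) (fun _ _ => erefl) erefl Sproj).
have DSres := kdual_linear_res hP ext0 extd P0.
have Sres : linear_res (gS (op B)) 0 d.+1.
  by exists P; split=> // n; rewrite add0r.
have [m [i [r hir]]] := gDS_summand S'proj.
have D'Sres := linear_res_summand hir Sres.
have [m1 [i1 [r1 hir1]]] := gS_summand Sgen.
have [m2 [i2 [r2 hir2]]] := gS_summand S'gen.
split; first by split; exact: kdual_generates_selfinjective.
split; split; [exact: linear_res_koszul DSres| |exact: linear_res_koszul D'Sres|].
  split=> [|n]; first exact: linear_res_pdim DSres.
  exact: (pdim_ge_ext hir1 extd' (@gDS_nonzero _ _ _)).
split=> [|n]; first exact: linear_res_pdim D'Sres.
exact: (pdim_ge_ext hir2 extd (@gDS_nonzero _ _ _)).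
Qed.
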